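(* Let $\frac12<\delta<1$ and $0<\rho<2-\frac1\delta$ be given. Let $k=k(d)$ and $N=N(d)$ be integers with $1\le k<d<N$ such that $$\delta_d:=\frac dN\to\delta,\qquad \rho_d:=\frac kd\to\rho\qquad\text{as } d\to\infty .$$ Then the Donoho--Tanner cones $D_N$ in $\mathbb{R}^d$ satisfy $$\binom Nk-\mathbb{E} f_k(D_N)=\frac1N\,e^{N G(\delta_d,\rho_d)}\cdot g(d),$$ where $g$ remains in a bounded positive interval, i.e. there are constants $0<a\le b<\infty$, independent of $d$, with $a\le g(d)\le b$ for all $d$. In particular, $$\lim_{d\to\infty}\left[\binom Nk-\mathbb{E} f_k(D_N)\right]=\begin{cases}0&\text{if }\rho<\rho_S(\delta),\\ \infty&\text{if }\rho>\rho_S(\delta).\end{cases}$$ If $\rho=\rho_S(\delta)$, then the numbers $N=N(d)$ and $k=k(d)$ (integers with $1\le k<d<N$, $\frac dN\to\delta$ and $\frac kd\to\rho$ as $d\to\infty$) can be chosen such that $$\liminf_{d\to\infty}\left[\binom Nk-\mathbb{E} f_k(D_N)\right]=0\quad\text{and}\quad\limsup_{d\to\infty}\left[\binom Nk-\mathbb{E} f_k(D_N)\right]=\infty.$$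
   Context: For each $d$, let $\phi=\phi_d$ be a probability measure on $\mathbb{R}^d$ which is even (i.e. $\phi(A)=\phi(-A)$ for Borel sets $A$) and assigns measure zero to each hyperplane through the origin. For $N\ge d+1$ let $X_1,\dots,X_N$ be independent random vectors with distribution $\phi$. The Donoho--Tanner random cone is $D_N:=\mathrm{pos}\{X_1,\dots,X_N\}$, where $\mathrm{pos}$ denotes the positive hull (set of all nonnegative linear combinations). For a polyhedral convex cone $C\subset\mathbb{R}^d$ and $k\in\{1,\dots,d-1\}$, $f_k(C)$ denotes the number of $k$-dimensional faces of $C$ (so $f_k(\mathbb{R}^d)=0$). $\mathbb{E}$ denotes expectation. The binary entropy function with base $e$ is $\mathsf{H}(x):=-x\log x-(1-x)\log(1-x)$ for $0\le x\le1$ (with $0\log 0=0$), and $$G(\delta,\rho):=\mathsf{H}(\delta)+\delta\,\mathsf{H}(\rho)-(1-\rho\delta)\log2\qquad\text{for }\rho,\delta\in[0,1].$$ For fixed $\delta\in(1/2,1)$, the function $x\mapsto G(\delta,x)$ has a unique zero in $[0,1]$ (a known fact), which is denoted by $\rho_S(\delta)$. *)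

(* Defs.v *)
From mathcomp Require Export all_boot all_order all_algebra.
From mathcomp Require Export finmap.
From mathcomp Require Export all_classical all_reals all_analysis.

Set Implicit Arguments.
Unset Strict Implicit.
Unset Printing Implicit Defensive.
Import Order.TTheory GRing.Theory Num.Theory.
Import numFieldTopology.Exports.
Local Open Scope classical_set_scope.
Local Open Scope ring_scope.

Notation borel_rV R d := (g_sigma_algebraType (@open 'rV[R]_d)).

Section Cones.
Context (R : realType) (d : nat).
Implicit Types (C F : set 'rV[R]_d) (u x : 'rV[R]_d).

Definition dotv u x : R := \sum_i u 0 i * x 0 i.

Definition pos N (v : 'I_N -> 'rV[R]_d) : set 'rV[R]_d :=
  [set x | exists2 c : 'I_N -> R, (forall i, 0 <= c i)
                                & x = \sum_i c i *: v i].

(* Faces of a polyhedral cone: [u = 0] gives the improper face [C]; a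
   hyperplane supporting a cone passes through the origin, so only linear
   functionals occur. *)
Definition is_face C F : Prop :=
  exists2 u, (forall x, C x -> 0 <= dotv u x)
           & F = C `&` [set x | dotv u x = 0].

(* The linear hull has dimension [k]; for nonempty faces of a cone, which
   contain 0, the linear hull is the affine hull. *)
Definition has_dim F (k : nat) : Prop :=
  exists V : {vspace 'rV[R]_d},
    [/\ forall x, F x -> x \in V,
        forall W : {vspace 'rV[R]_d}, (forall x, F x -> x \in W) -> (V <= W)%VS
      & \dim V = k].

(* [fset_set] sends an infinite set to the empty one, but a polyhedral cone
   has finitely many faces. *)
Definition num_faces (k : nat) C : nat :=
  #|` fset_set [set F | is_face C F /\ has_dim F k] |%fset.

End Cones.

Section Samples.
Context (R : realType) (d : nat).

Definition even_measure (phi : probability (borel_rV R d) R) : Prop :=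
  forall A : set (borel_rV R d), measurable A ->
    phi [set - (x : 'rV[R]_d) | x in A] = phi A.

Definition null_on_hyperplanes (phi : probability (borel_rV R d) R) : Prop :=
  forall u : 'rV[R]_d, u != 0 ->
    phi [set x : borel_rV R d | dotv u (x : 'rV[R]_d) = 0] = 0%E.

Definition iid_sample disp (Omega : measurableType disp)
    (P : probability Omega R) (phi : probability (borel_rV R d) R)
    N (X : 'I_N -> {RV P >-> borel_rV R d}) : Prop :=
  (forall i (A : set (borel_rV R d)), measurable A ->
     distribution P (X i) A = phi A) /\
  (forall (J : {set 'I_N}) (A : 'I_N -> set (borel_rV R d)),
     (forall i, measurable (A i)) ->
     P (\bigcap_(i in [set` J]) (X i @^-1` A i))
     = (\prod_(i in J) P (X i @^-1` A i))%E).

Definition DT_cone disp (Omega : measurableType disp)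
    (P : probability Omega R) N (X : 'I_N -> {RV P >-> borel_rV R d})
    (w : Omega) : set 'rV[R]_d :=
  pos (fun i => (X i w : 'rV[R]_d)).

Definition expected_faces disp (Omega : measurableType disp)
    (P : probability Omega R) N (X : 'I_N -> {RV P >-> borel_rV R d})
    (k : nat) : \bar R :=
  'E_P[fun w => (num_faces k (DT_cone X w))%:R]%E.

Definition face_defect disp (Omega : measurableType disp)
    (P : probability Omega R) N (X : 'I_N -> {RV P >-> borel_rV R d})
    (k : nat) : \bar R :=
  (('C(N, k))%:R%:E - expected_faces X k)%E.

End Samples.

Definition entropy (R : realType) (x : R) : R :=
  - x * ln x - (1 - x) * ln (1 - x).

Definition G (R : realType) (delta rho : R) : R :=
  entropy delta + delta * entropy rho - (1 - rho * delta) * ln 2.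

(* The zero exists and is unique for [1/2 < delta < 1]; otherwise the value of
   [rho_S] is irrelevant. *)
Definition rho_S (R : realType) (delta : R) : R :=
  xget 0 [set x : R | 0 <= x <= 1 /\ G delta x = 0].

(* No integer [k] satisfies [1 <= k < d] when [d < 2], so the sequences are
   constrained from [d = 2] on. *)
Definition admissible (R : realType) (delta rho : R) (k N : nat -> nat) : Prop :=
  [/\ forall d : nat, (2 <= d)%N -> [&& 1 <= k d, k d < d & d < N d]%N,
      (d%:R / (N d)%:R : R) @[d --> \oo] --> delta
    & ((k d)%:R / d%:R : R) @[d --> \oo] --> rho].

(* Main.v *)
From HB Require Import structures.
Require Import Defs.
From mathcomp Require Import measurable_realfun zify ring lra.
Set Implicit Arguments.
Unset Strict Implicit.
Unset Printing Implicit Defensive.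
Import Order.TTheory GRing.Theory Num.Theory.
Import numFieldTopology.Exports.
Local Open Scope classical_set_scope.
Local Open Scope ring_scope.

(** For points in general position, a set [S] of [k < d] generators spans a
   face of the cone iff some linear functional vanishes on [S] and is positive
   off [S].  Since the sample is even, the probability of this does not change
   when the signs prescribed off [S] are changed, so it is the number of
   realizable sign patterns divided by [2 ^ (N - k)].  That number does not
   depend on the points (Schlaefli, Wendel): a pattern on [T] extends to both
   signs of a further point [x] iff it is realizable on the hyperplane orthogonal
   to [x], which gives a Pascal-type recursion.  Hence the defect is
   ['C(N, k)] times the upper tail, from [d - k] on, of a symmetric binomial
   distribution on [N - k - 1] trials.  The condition [rho < 2 - 1 / delta] puts
   the tail above the mean with a ratio of consecutive terms bounded away from
   1, so the tail is comparable with its first term, and Stirling's formula turns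
   ['C(N, d) * 'C(d, k)] into [exp (N G) / N].  The sign of [G delta] around
   [rho_S delta] comes from concavity in [rho], and the oscillating sequences at
   [rho_S delta] are a diagonal extraction from sequences with limits slightly
   below and slightly above. *)

(** * Sign patterns of points in general position *)

Section DotProduct.
Context (R : realType) (d : nat).
Implicit Types u v x : 'rV[R]_d.

Lemma dotvC u x : dotv u x = dotv x u.
Proof. by apply: eq_bigr => i _; rewrite mulrC. Qed.

Lemma dotvDl u v x : dotv (u + v) x = dotv u x + dotv v x.
Proof. by rewrite /dotv -big_split; apply: eq_bigr => i _; rewrite !mxE mulrDl. Qed.

Lemma dotvZl a u x : dotv (a *: u) x = a * dotv u x.
Proof. by rewrite /dotv mulr_sumr; apply: eq_bigr => i _; rewrite !mxE mulrA. Qed.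

Lemma dotv0l x : dotv 0 x = 0.
Proof. by rewrite /dotv big1 // => i _; rewrite mxE mul0r. Qed.

Lemma dotv_sumr u (I : Type) (r : seq I) (Q : pred I) (y : I -> 'rV[R]_d) :
  dotv u (\sum_(i <- r | Q i) y i) = \sum_(i <- r | Q i) dotv u (y i).
Proof.
elim/big_rec2: _ => [|i a y' _ <-]; first by rewrite dotvC dotv0l.
by rewrite dotvC dotvDl dotvC [dotv _ u]dotvC.
Qed.

Lemma dotvZr u a x : dotv u (a *: x) = a * dotv u x.
Proof. by rewrite dotvC dotvZl dotvC. Qed.

Lemma dotvv_eq0 u : dotv u u = 0 -> u = 0.
Proof.
move=> /eqP; rewrite psumr_eq0; last by move=> i _; rewrite -expr2 sqr_ge0.
move=> /allP u0; apply/rowP => i; rewrite mxE; apply/eqP.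
by have := u0 i (mem_index_enum i); rewrite mulf_eq0 orbb.
Qed.

Lemma dotv_span u (s : seq 'rV[R]_d) y :
  (forall x, x \in s -> dotv u x = 0) -> y \in << s >>%VS -> dotv u y = 0.
Proof.
move=> us ys; rewrite (coord_span (X := in_tuple s) ys) dotv_sumr.
by rewrite big1 // => i _; rewrite dotvZr us ?mulr0// mem_nth.
Qed.

End DotProduct.

(** Equivalently, any at most [d] of the vectors with distinct indices are linearly independent. The
    functional [v] is the direction in which solutions are perturbed later. *)
Definition general_position (R : realType) d N (x : 'I_N -> 'rV[R]_d) : Prop :=
  forall (S : {set 'I_N}) i, i \notin S -> (#|S| < d)%N ->
  exists2 v, forall j, j \in S -> dotv v (x j) = 0 & dotv v (x i) != 0.

(** [S] is a zero set and [E] a set of negative signs. Restricting to the hyperplane orthogonal to a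
    point amounts to moving its index from [T] to [S], so the ambient space never changes. *)
Definition realizes (R : realType) d N (x : 'I_N -> 'rV[R]_d)
    (S T E : {set 'I_N}) : Prop :=
  exists2 u, forall j, j \in S -> dotv u (x j) = 0
           & forall j, j \in T ->
               if j \in E then dotv u (x j) < 0 else 0 < dotv u (x j).

(* The number of regions into which [t] hyperplanes in general position through
   the origin divide an [m]-dimensional space. *)
Fixpoint regions (m t : nat) : nat :=
  match t, m with
  | 0, _ => 1
  | _.+1, 0 => 0
  | t'.+1, m'.+1 => regions m t' + regions m' t'
  end.

Section GeneralPosition.
Context (R : realType) (d N : nat) (x : 'I_N -> 'rV[R]_d).
Hypothesis gp : general_position x.
Implicit Types S T E : {set 'I_N}.

Lemma gp_free (s : seq 'I_N) : uniq s -> (size s <= d)%N -> free (map x s).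
Proof.
elim: s => [|i s IH] /=; first by move=> _ _; rewrite nil_free.
move=> /andP[is_ us] sd; rewrite free_cons IH ?(ltnW sd)// andbT.
have [||v vs vi] := gp (S := [set j in s]%SET) (i := i).
- by rewrite inE.
- by rewrite cardsE (card_uniqP us).
apply: contra vi => xi; apply/eqP; apply: dotv_span xi.
by move=> _ /mapP[j js ->]; apply: vs; rewrite inE.
Qed.

(** [d] independent points span the whole space, so [u] is orthogonal to itself. *)
Lemma gp_orthogonal_eq0 S u :
  (d <= #|S|)%N -> (forall j, j \in S -> dotv u (x j) = 0) -> u = 0.
Proof.
move=> dS uS; pose s := take d (enum S).
have ss : size s = d by rewrite size_take -cardE; case: ltngtP dS.
have fr : free (map x s).
  by apply: gp_free; rewrite ?take_uniq ?enum_uniq ?ss.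
have full : <<map x s>>%VS = fullv.
  apply/eqP; rewrite eqEdim subvf /= dimvf /dim /= mul1n.
  by move: fr; rewrite /free size_map ss => /eqP->.
apply: dotvv_eq0; apply: (@dotv_span _ _ _ (map x s)); last by rewrite full memvf.
move=> _ /mapP[j js ->]; apply: uS; rewrite -mem_enum; exact: mem_take js.
Qed.

Lemma realizes_perturb S T E u v :
  (forall j, j \in T -> if j \in E then dotv u (x j) < 0 else 0 < dotv u (x j)) ->
  exists2 e, 0 < e & forall t j, `|t| <= e -> j \in T ->
    if j \in E then dotv (u + t *: v) (x j) < 0 else 0 < dotv (u + t *: v) (x j).
Proof.
move=> uT.
(* The summand 1 keeps the denominator positive when [v] is orthogonal to [x j], and makes the
   resulting estimate strict. *)
pose q j := `|dotv u (x j)| / (1 + `|dotv v (x j)|).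
have den0 j : 0 < 1 + `|dotv v (x j)| by rewrite ltr_pwDl.
exists (\big[Num.min/1]_(j in T) q j).
  apply/bigmin_gtP; split => // j jT; rewrite divr_gt0 // normr_gt0.
  by move: (uT j jT); case: ifP => _; [exact: ltr0_neq0|exact: lt0r_neq0].
move=> t j te jT.
have tq : `|t| <= q j by apply: le_trans te _; apply: bigmin_le_cond.
have tv : `|t * dotv v (x j)| < `|dotv u (x j)|.
  have u0 : 0 < `|dotv u (x j)|.
    rewrite normr_gt0.
    by move: (uT j jT); case: ifP => _; [exact: ltr0_neq0|exact: lt0r_neq0].
  rewrite normrM; move: tq; rewrite /q ler_pdivlMr // mulrDr mulr1 addrC.
  have [->|t0] := eqVneq t 0; first by rewrite normr0 mul0r.
  have : 0 < `|t| by rewrite normr_gt0.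
  by move=> tp tq; apply: lt_le_trans tq; rewrite ltrDl.
move: (uT j jT) tv; rewrite dotvDl dotvZl; case: ifP => _ uj.
  by rewrite (ltr0_norm uj) ltr_norml => /andP[]; lra.
by rewrite (gtr0_norm uj) ltr_norml => /andP[]; lra.
Qed.

(** A slight tilt of [u] along [v], in either direction, gives [x i] either sign, keeps the zeros on
    [S] and is too small to affect the signs on [T]. *)
Lemma realizes_extend S T E u i v :
  i \notin T -> (forall j, j \in S -> dotv u (x j) = 0) ->
  (forall j, j \in T -> if j \in E then dotv u (x j) < 0 else 0 < dotv u (x j)) ->
  (forall j, j \in S -> dotv v (x j) = 0) -> dotv v (x i) != 0 ->
  dotv u (x i) = 0 ->
  realizes x S (i |: T) (E :\ i) /\ realizes x S (i |: T) (i |: E).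
Proof.
move=> iT uS uT vS vi ui; have [e e0 ue] := realizes_perturb S v uT.
pose s := Num.sg (dotv v (x i)).
have s1 : `|s| = 1 by rewrite normr_sg vi.
have sv : 0 < s * dotv v (x i) by rewrite -normrEsg normr_gt0.
split.
  exists (u + (e * s) *: v) => j.
    by move=> jS; rewrite dotvDl dotvZl uS // vS // mulr0 addr0.
  rewrite !inE; have [->|ji] /= := eqVneq j i.
    by move=> _; rewrite dotvDl ui add0r dotvZl -mulrA mulr_gt0.
  by move=> jT; apply: ue => //; rewrite normrM s1 mulr1 gtr0_norm.
exists (u + (- (e * s)) *: v) => j.
  by move=> jS; rewrite dotvDl dotvZl uS // vS // mulr0 addr0.
rewrite !inE; have [->|ji] /= := eqVneq j i.
  by move=> _; rewrite dotvDl ui add0r dotvZl mulNr oppr_lt0 -mulrA mulr_gt0.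
by move=> jT; apply: ue => //; rewrite normrN normrM s1 mulr1 gtr0_norm.
Qed.

(** A functional vanishing at [x i] can be tilted to both sides. Conversely, two functionals of
    opposite signs at [x i] have a combination with positive weights that vanishes there, and it
    keeps the signs on which both agree. *)
Lemma realizes_setU1l S T E i :
  i \notin S -> i \notin T -> (#|S| < d)%N ->
  realizes x (i |: S) T E <->
  realizes x S (i |: T) (E :\ i) /\ realizes x S (i |: T) (i |: E).
Proof.
move=> iS iT Sd; split.
  move=> [u uS uT]; have [v vS vi] := gp iS Sd.
  apply: (@realizes_extend _ _ _ u i v) => //.
    by move=> j jS; rewrite uS // inE jS orbT.
  by rewrite uS // setU11.
move=> [[u uS uT] [v vS vT]].
have ui : 0 < dotv u (x i) by have := uT i (setU11 _ _); rewrite !inE eqxx.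
have vi : dotv v (x i) < 0 by have := vT i (setU11 _ _); rewrite !inE eqxx.
exists (- dotv v (x i) *: u + dotv u (x i) *: v) => j.
  rewrite !inE dotvDl !dotvZl => /orP[/eqP->|jS]; first by ring.
  by rewrite (uS _ jS) (vS _ jS) !mulr0 addr0.
move=> jT; have ji : j != i by apply: contraNneq iT => <-.
have := uT j; have := vT j; rewrite !inE jT orbT (negPf ji) /= dotvDl !dotvZl.
by move=> /(_ isT) + /(_ isT); case: ifP => _ h1 h2; nra.
Qed.

Lemma realizes_setU1r S T E i :
  i \notin S -> i \notin T -> (#|S| < d)%N ->
  realizes x S T E <->
  realizes x S (i |: T) (E :\ i) \/ realizes x S (i |: T) (i |: E).
Proof.
move=> iS iT Sd; split.
  move=> [u uS uT]; have [v vS vi] := gp iS Sd.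
  have [ui|ui|ui] := ltgtP (dotv u (x i)) 0.
  - right; exists u => // j; rewrite !inE; have [->|ji] //= := eqVneq j i.
    exact: uT.
  - left; exists u => // j; rewrite !inE; have [->|ji] //= := eqVneq j i.
    exact: uT.
  - by left; have [] := @realizes_extend S T E u i v.
have ji j : j \in T -> j != i by move=> jT; apply: contraNneq iT => <-.
move=> [] [u uS uT]; exists u => // j jT.
  by have := uT j; rewrite !inE jT orbT (ji j jT) /=; apply.
by have := uT j; rewrite !inE jT orbT (negPf (ji j jT)) /=; apply.
Qed.

Definition sign_sets S T : {set {set 'I_N}} :=
  [set E : {set 'I_N} in powerset T | `[< realizes x S T E >]]%SET.

(** Deletion and restriction: let [A] and [B] hold the patterns on [T] that extend by a positive,
    respectively negative, sign at [i]. Their union consists of all patterns on [T], their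
    intersection of those realizable with a zero at [i]. *)
Lemma card_sign_setsU1 S T i : i \notin S -> i \notin T -> (#|S| < d)%N ->
  #|sign_sets S (i |: T)| = (#|sign_sets S T| + #|sign_sets (i |: S) T|)%N.
Proof.
move=> iS iT Sd.
have subT (E : {set 'I_N}) : E \subset T -> i \notin E.
  by move=> ET; apply: contra iT; exact: (fintype.subsetP ET).
pose A := [set E : {set 'I_N} in powerset T | `[< realizes x S (i |: T) E >]]%SET.
pose B := [set E : {set 'I_N} in powerset T |
            `[< realizes x S (i |: T) (i |: E) >]]%SET.
have -> : sign_sets S T = A :|: B.
  apply/setP => E; rewrite !inE -andb_orr; case: (boolP (E \subset T)) => //= ET.
  have Ei : E :\ i = E by apply/finset.setDidPl;
    rewrite fintype.disjoint_sym finset.disjoints1 subT.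
  by rewrite -asbool_or; apply: asbool_equiv_eq; rewrite -{2}Ei; exact: realizes_setU1r.
have -> : sign_sets (i |: S) T = A :&: B.
  apply/setP => E; rewrite !inE andbACA andbb; case: (boolP (E \subset T)) => //= ET.
  have Ei : E :\ i = E by apply/finset.setDidPl;
    rewrite fintype.disjoint_sym finset.disjoints1 subT.
  by rewrite -asbool_and; apply: asbool_equiv_eq; rewrite -{2}Ei; exact: realizes_setU1l.
(* The right side is the sum of the sizes of [A] and [B]. Adding [i] to the members of [B] makes the
   two families disjoint, and their union is then the family on the left. *)
rewrite cardsUI -(card_in_imset (f := fun E => i |: E) (D := B)); last first.
  move=> E F; rewrite !inE => /andP[ET _] /andP[FT _] EF.
  by rewrite -(setU1K (subT _ ET)) -(setU1K (subT _ FT)) EF.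
rewrite -cardsUI (_ : A :&: _ = finset.set0) ?cards0 ?addn0; last first.
  apply/setP => E; rewrite !inE; apply/negP => /andP[/andP[ET _]].
  by move=> /imsetP[F _ EF]; have := subT _ ET; rewrite EF setU11.
congr #|pred_of_set _|; apply/setP => E; rewrite !inE.
have [iE|iE] := boolP (i \in E).
  rewrite [E \subset T](contraTF _ iE) ?andFb //=; last exact: subT.
  apply/andP/imsetP.
    move=> [ET rE]; exists (E :\ i); last by rewrite finset.setD1K.
    by rewrite !inE finset.setD1K // rE andbT finset.subDset.
  move=> [F]; rewrite !inE => /andP[FT rF] ->; split; last exact/asboolP.
  by rewrite finset.setUS.
have -> : (E \subset i |: T) = (E \subset T).
  have Ei : E :\ i = E.
    by apply/finset.setDidPl; rewrite fintype.disjoint_sym finset.disjoints1.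
  by rewrite -finset.subDset Ei.
case: imsetP; last by rewrite orbF.
by move=> [F _ EF]; rewrite EF setU11 in iE.
Qed.

Lemma card_sign_sets S T : (forall i, i \in S -> i \notin T) -> (#|S| <= d)%N ->
  #|sign_sets S T| = regions (d - #|S|) #|T|.
Proof.
elim: {T}_.+1 {-2}T S (ltnSn #|T|) => // n IH T S Tn ST Sd.
have [->|[i iT]] := set_0Vmem T.
  rewrite cards0 /= /sign_sets powerset0 -(cards1 (finset.set0 : {set 'I_N})).
  congr #|pred_of_set _|; apply/setP => E; rewrite !inE andbC; case: eqP => [->|];
    last by rewrite andbF.
  rewrite andbT; apply/asboolP; exists 0 => j; first by rewrite dotv0l.
  by rewrite inE.
have iS : i \notin S by apply: contraL iT => /ST.
rewrite -(finset.setD1K iT) cardsU1 finset.setD11 add1n.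
have Tn' : (#|T :\ i| < n)%N by rewrite (cardsD1 i T) iT in Tn; rewrite -ltnS.
have ST' j : j \in S -> j \notin T :\ i by move=> /ST; rewrite !inE negb_and orbC => ->.
(* With [d] zeros only the zero functional remains, which realizes no strict sign at [i]; this is
   the clause of [regions] with value 0. *)
move: Sd; rewrite leq_eqVlt => /orP[/eqP Sd|Sd].
  rewrite Sd subnn; apply/eqP; rewrite cards_eq0; apply/eqP/setP => E.
  rewrite !inE; apply/negP => /andP[_ /asboolP[u uS uT]].
  have u0 : u = 0 by apply: gp_orthogonal_eq0 uS; rewrite Sd.
  have := uT i; rewrite !inE eqxx /= u0 dotv0l => /(_ isT).
  by case: ifP; rewrite ltxx.
rewrite card_sign_setsU1 // ?finset.setD11 // !IH ?cardsU1 ?iS ?(ltnW Sd)//; last first.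
  by move=> j; rewrite !inE => /orP[/eqP->|/ST']; rewrite ?eqxx // !inE.
by rewrite add1n -(subSS #|S|) subSn.
Qed.

End GeneralPosition.

(** * Faces of a polyhedral cone in general position *)

(** Pascal's rule gives both sides the same recursion. The formula starts at one hyperplane because
    [regions m 0] is 1, which is odd. *)
Lemma regionsE m t : regions m t.+1 = (2 * \sum_(i < m) 'C(t, i))%N.
Proof.
elim: t m => [|t IH] [|m].
- by rewrite big_ord0.
- by rewrite /= big_ord_recl bin0 big1.
- by rewrite big_ord0.
have -> : regions m.+1 t.+2 = (regions m.+1 t.+1 + regions m t.+1)%N by [].
rewrite !IH -mulnDr; congr (2 * _)%N.
rewrite [RHS]big_ord_recl bin0 big_ord_recl bin0 -addnA; congr (1 + _)%N.
by rewrite -big_split; apply: eq_bigr => i _; rewrite /= /bump /= add1n binS.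
Qed.

Section Faces.
Context (R : realType) (d N : nat) (x : 'I_N -> 'rV[R]_d).
Hypothesis gp : general_position x.
Implicit Types S T E : {set 'I_N}.

Lemma mem_pos i : pos x (x i).
Proof.
exists (fun j => (j == i)%:R) => [j|]; first by rewrite ler0n.
rewrite (bigD1 i) //= eqxx scale1r big1 ?addr0 // => j /negPf->.
by rewrite scale0r.
Qed.

Definition subcone S : set 'rV[R]_d :=
  [set y | exists2 c : 'I_N -> R, (forall i, 0 <= c i)
                                & y = \sum_(i in S) c i *: x i].

(** A sum of nonnegative terms vanishes only if each term does, so a point of the cone on the
    supporting hyperplane has zero coefficients off [S]. *)
Lemma pos_supporting_subcone S u :
  (forall i, i \in S -> dotv u (x i) = 0) ->
  (forall i, i \notin S -> 0 < dotv u (x i)) ->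
  pos x `&` [set y | dotv u y = 0] = subcone S.
Proof.
move=> uS uT; apply/seteqP; split=> y /=.
  move=> [[c c0 ->] uy]; exists c => //.
  rewrite (bigID (mem S)) /= [X in _ + X]big1 ?addr0 // => i iS.
  have /eqP : dotv u (\sum_i c i *: x i) = 0 by [].
  rewrite dotv_sumr psumr_eq0; last first.
    move=> j _; rewrite dotvZr mulr_ge0 //.
    by have [/uS->|/uT/ltW] := boolP (j \in S).
  move=> /allP /(_ i (mem_index_enum _)) /=.
  by rewrite dotvZr mulf_eq0 (gt_eqF (uT i iS)) orbF => /eqP ->; rewrite scale0r.
move=> [c c0 ->]; split.
  exists (fun i => if i \in S then c i else 0) => [i|]; first by case: ifP.
  rewrite [RHS](bigID (mem S)) /= [X in _ + X]big1 ?addr0.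
    by apply: eq_bigr => i ->.
  by move=> i /negPf->; rewrite scale0r.
by rewrite dotv_sumr big1 // => i iS; rewrite dotvZr uS ?mulr0.
Qed.

Lemma has_dim_subcone S k :
  has_dim (subcone S) k <-> \dim <<[seq x i | i <- enum S]>>%VS = k.
Proof.
have sub y : subcone S y -> y \in <<[seq x i | i <- enum S]>>%VS.
  move=> [c _ ->]; apply: memv_suml => i iS; apply/memvZ/memv_span/map_f.
  by rewrite mem_enum.
have min (W : {vspace 'rV[R]_d}) : (forall y, subcone S y -> y \in W) ->
    (<<[seq x i | i <- enum S]>> <= W)%VS.
  move=> SW; apply/span_subvP => _ /mapP[i iS ->]; apply: SW.
  exists (fun j => (j == i)%:R) => [j|]; first by rewrite ler0n.
  rewrite mem_enum in iS.
  rewrite (bigD1 i) //= eqxx scale1r big1 ?addr0 // => j /andP[_ /negPf->].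
  by rewrite scale0r.
split.
  move=> [V [SV Vmin <-]]; congr (\dim _); apply/eqP; rewrite eqEsubv.
  by rewrite min //= Vmin.
by move=> dk; exists <<[seq x i | i <- enum S]>>%VS; split.
Qed.

(** The bound [k < d] disposes of the sets of more than [d] points, whose span has dimension at
    least [d]. *)
Lemma dim_span_gp S k : (k < d)%N ->
  (\dim <<[seq x i | i <- enum S]>>%VS == k) = (#|S| == k).
Proof.
move=> kd; have [Sd|dS] := leqP #|S| d.
  have := gp_free gp (enum_uniq (mem S)).
  by rewrite -cardE => /(_ Sd); rewrite /free size_map -cardE => /eqP->.
rewrite [RHS]gtn_eqF ?(ltn_trans kd) //; apply: gtn_eqF; apply: (leq_trans kd).
have ss : size (take d (enum S)) = d by rewrite size_take -cardE dS.
have := gp_free gp (take_uniq d (enum_uniq (mem S))).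
rewrite ss leqnn => /(_ isT); rewrite /free size_map ss => /eqP {1}<-.
apply/dimvS/sub_span => _ /mapP[i iS ->]; apply: map_f; exact: mem_take iS.
Qed.

(** A face corresponds to the set [S] of generators lying on its supporting hyperplane. The map from
    [S] to the face is injective because [S] is recovered as the set of generators that the face
    contains. *)
Lemma num_faces_pos k : (k < d)%N ->
  num_faces k (pos x)
    = #|[set S : {set 'I_N} | (#|S| == k)
                          && `[< realizes x S (~: S) finset.set0 >]]%SET|.
Proof.
move=> kd; set B := [set S : {set 'I_N} | _]%SET.
have rP S u : (forall i, i \in ~: S -> if i \in finset.set0
     then dotv u (x i) < 0 else 0 < dotv u (x i)) ->
     forall i, i \notin S -> 0 < dotv u (x i).
  by move=> uT i iS; have := uT i; rewrite !inE iS; apply.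
rewrite /num_faces.
have -> : [set F | is_face (pos x) F /\ has_dim F k] =
          subcone @` [set` B].
  apply/seteqP; split => F /=.
    move=> [[u u0 ->] dimF].
    pose S := [set i | dotv u (x i) == 0]%SET.
    have uS i : i \in S -> dotv u (x i) = 0 by rewrite inE => /eqP.
    have uT i : i \notin S -> 0 < dotv u (x i).
      by rewrite inE lt_neqAle eq_sym => ->; apply/u0/mem_pos.
    move: dimF; rewrite (pos_supporting_subcone uS uT) => dimF.
    exists S => //; rewrite inE -(dim_span_gp S kd); apply/andP; split.
      by apply/eqP/has_dim_subcone.
    apply/asboolP; exists u => // i.
    by rewrite finset.in_setC finset.in_set0 => /uT.
  move=> [S]; rewrite inE => /andP[Sk /asboolP[u uS /rP uT]] <-; split.
    exists u; last by rewrite (pos_supporting_subcone uS uT).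
    move=> _ [c c0 ->]; rewrite dotv_sumr sumr_ge0 // => i _.
    rewrite dotvZr mulr_ge0 //; have [/uS->//|/uT/ltW//] := boolP (i \in S).
  by apply/has_dim_subcone/eqP; rewrite dim_span_gp.
rewrite fset_set_image; last exact: finite_finset.
rewrite card_in_imfset /=; last first.
  move=> S T; rewrite !in_fset_set ?inE; try exact: finite_finset.
  rewrite /= !inE => /andP[Sk /asboolP[u uS /rP uT]] /andP[Tk /asboolP[v vS /rP vT]].
  rewrite -(pos_supporting_subcone uS uT) -(pos_supporting_subcone vS vT).
  move=> ST; have eqS i : (i \in S) = (i \in T).
    have := mem_pos i => xi.
    have [hu hv] : (pos x `&` [set y | dotv u y = 0]) (x i) <->
                   (pos x `&` [set y | dotv v y = 0]) (x i) by rewrite ST.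
    have uv : (dotv u (x i) = 0) <-> (dotv v (x i) = 0).
      by split=> e; [have [] := hu (conj xi e)|have [] := hv (conj xi e)].
    apply/idP/idP => [/uS/uv vi|/vS/uv ui]; apply: contraT.
      by move=> /vT; rewrite vi ltxx.
    by move=> /uT; rewrite ui ltxx.
  by apply/setP.
rewrite cardE; apply/perm_size/uniq_perm; rewrite ?enum_uniq ?fset_uniq //.
move=> S; rewrite mem_enum in_fset_set; last exact: finite_finset.
by rewrite mem_setE.
Qed.

End Faces.

(** * Borel structure on tuples of vectors *)

Section BorelVectors.
Context (R : realType) (d : nat).
Local Notation V := (borel_rV R d).

Lemma measurable_coord (a : 'I_d) :
  measurable_fun setT (fun y : V => (y : 'rV[R]_d) 0 a).
Proof.
apply: (measurability _ (RGenOpens.measurableE R)).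
move=> _ [_ [s [t ->] <-]]; rewrite setTI; apply: sub_sigma_algebra.
by apply: open_comp; [move=> y _; exact: coord_continuous|exact: interval_open].
Qed.

Lemma measurable_oppv : measurable_fun setT (fun y : V => - (y : 'rV[R]_d) : V).
Proof.
apply: (@measurability _ _ V V setT _ (@open 'rV[R]_d) erefl) => _ [U oU <-].
rewrite setTI; apply: sub_sigma_algebra.
by apply: open_comp => // y _; apply: continuousN; exact: cvg_id.
Qed.

Lemma measurable_dotv disp (T : measurableType disp) (f g : T -> V) :
  measurable_fun setT f -> measurable_fun setT g ->
  measurable_fun setT (fun t => dotv (f t) (g t)).
Proof.
move=> mf mg; apply: measurable_sum => a.
by apply: measurable_funM; apply: (measurableT_comp (measurable_coord a)).
Qed.

End BorelVectors.

Section TupleSpace.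
Context (R : realType) (d N : nat).
Local Notation V := (borel_rV R d).
Implicit Types J : {set 'I_N}.

(** Only the coordinates in [J] are constrained, but the tuples are always indexed by all of ['I_N].
    A subfamily of the sample thus differs from the full one in its sigma-algebra only, not in its
    underlying type. *)
Definition rectangle J (A : 'I_N -> set V) : set ('I_N -> 'rV[R]_d) :=
  [set x | forall i, i \in J -> A i (x i)].

Definition rectangles J : set (set ('I_N -> 'rV[R]_d)) :=
  [set B | exists2 A : 'I_N -> set V, (forall i, measurable (A i))
                                    & B = rectangle J A].

Local Notation tuples J := (g_sigma_algebraType (rectangles J)).

Lemma rectangles_setI J : setI_closed (rectangles J).
Proof.
move=> _ _ [A mA ->] [B mB ->]; exists (fun i => A i `&` B i).
  by move=> i; exact: measurableI.
apply/seteqP; split=> x /=; first by move=> [xA xB] i iJ; split; [exact: xA|exact: xB].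
by move=> xAB; split=> i /xAB[].
Qed.

Lemma rectangles_setT J : rectangles J setT.
Proof. by exists (fun=> setT) => //; apply/seteqP; split. Qed.

Lemma preimage_rectangle (T : Type) (X : 'I_N -> T -> V) J A :
  (fun w => X ^~ w) @^-1` rectangle J A = \bigcap_(i in [set` J]) (X i @^-1` A i).
Proof. by []. Qed.

Lemma measurable_rectangle disp (T : measurableType disp) (X : 'I_N -> T -> V) J A :
  (forall i, measurable_fun setT (X i)) -> (forall i, measurable (A i)) ->
  measurable ((fun w => X ^~ w) @^-1` rectangle J A).
Proof.
move=> mX mA; rewrite preimage_rectangle; apply: fin_bigcap_measurable => //.
by move=> i _; rewrite -[X in measurable X]setTI; exact: mX.
Qed.

Lemma measurable_tuple disp (T : measurableType disp) (X : 'I_N -> T -> V) J :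
  (forall i, measurable_fun setT (X i)) ->
  measurable_fun setT ((fun w => X ^~ w) : T -> tuples J).
Proof.
move=> mX; apply: (@measurability _ _ T (tuples J) setT _ (rectangles J) erefl) => _
  [_ [A mA ->] <-].
by rewrite setTI; exact: measurable_rectangle.
Qed.

Lemma measurable_eval J j : j \in J ->
  measurable_fun setT (fun x : tuples J => (x : 'I_N -> 'rV[R]_d) j : V).
Proof.
move=> jJ _ A mA; rewrite setTI; apply: sub_sigma_algebra.
exists (fun i => if i == j then A else setT) => [i|]; first by case: ifP.
apply/seteqP; split=> x /=; last by move=> /(_ j jJ); rewrite eqxx.
by move=> xA i iJ; case: eqP => // ->.
Qed.

(* Rational vectors suffice because strict inequalities are stable. *)
Lemma realizes_ratP (x : 'I_N -> 'rV[R]_d) (E : {set 'I_N}) :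
  realizes x finset.set0 [set: 'I_N] E <->
  exists q : 'rV[rat]_d, forall i,
    if i \in E then dotv (map_mx ratr q) (x i) < 0
               else 0 < dotv (map_mx ratr q) (x i).
Proof.
split; last first.
  by move=> [q xq]; exists (map_mx ratr q) => i; [rewrite finset.in_set0|move=> _;
    exact: xq].
move=> [u _ ux]; have {}ux i := ux i (finset.in_setT i).
(* An error below [e] in each coordinate of [u] changes the value at [x i] by at most [e] times the
   sum of the absolute coordinates of [x i]. *)
pose q i := `|dotv u (x i)| / (1 + \sum_a `|x i 0 a|).
have den0 i : 0 < 1 + \sum_a `|x i 0 a| by rewrite ltr_pwDl ?sumr_ge0.
have u0 i : 0 < `|dotv u (x i)|.
  rewrite normr_gt0.
  by move: (ux i); case: ifP => _; [exact: ltr0_neq0|exact: lt0r_neq0].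
pose e := \big[Num.min/1]_i q i.
have e0 : 0 < e by apply/bigmin_gtP; split => // i _; rewrite divr_gt0.
have /choice[p pu] : forall a, exists p : rat, u 0 a < ratr p < u 0 a + e.
  move=> a; have [|p] := @rat_in_itvoo R (u 0 a) (u 0 a + e); first by rewrite ltrDl.
  by rewrite in_itv; exists p.
exists (\row_a p a) => i.
have : `|dotv (map_mx ratr (\row_a p a)) (x i) - dotv u (x i)| < `|dotv u (x i)|.
  rewrite -sumrB; apply: (@le_lt_trans _ _ (e * \sum_a `|x i 0 a|)).
    apply: le_trans (ler_norm_sum _ _ _) _; rewrite mulr_sumr.
    apply: ler_sum => a _; rewrite !mxE -mulrBl normrM ler_wpM2r //.
    by have /andP[p1 p2] := pu a; rewrite ger0_norm; lra.
  have : e <= q i by exact: bigmin_le.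
  rewrite /q ler_pdivlMr // mulrDr mulr1; lra.
move: (ux i); case: ifP => _ ui.
  by rewrite (ltr0_norm ui) ltr_norml => /andP[]; lra.
by rewrite (gtr0_norm ui) ltr_norml => /andP[]; lra.
Qed.

(** The event is a countable union of rectangles, one for each rational functional. *)
Lemma measurable_realizesT (E : {set 'I_N}) :
  (@measurable _ (tuples [set: 'I_N]%SET))
    [set x | realizes x finset.set0 [set: 'I_N]%SET E].
Proof.
have -> : [set x | realizes x finset.set0 [set: 'I_N]%SET E] =
  \bigcup_(q in [set: 'rV[rat]_d]) rectangle [set: 'I_N]%SET (fun i =>
    if i \in E then [set y : V | dotv (map_mx ratr q) (y : 'rV[R]_d) < 0]
               else [set y : V | 0 < dotv (map_mx ratr q) (y : 'rV[R]_d)]).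
  apply/seteqP; split=> x /=.
    by move=> /realizes_ratP[q xq]; exists q => // i _; move: (xq i); case: ifP.
  by move=> [q _ xq]; apply/realizes_ratP; exists q => i;
    move: (xq i (finset.in_setT i)); case: ifP.
apply: countable_bigcupT_measurable => [|q]; first exact: countableP.
apply: sub_sigma_algebra; eexists; last reflexivity.
have mq : measurable_fun setT (fun y : V => dotv (map_mx ratr q) (y : 'rV[R]_d)).
  by apply: (@measurable_dotv _ _ _ _ (cst _) id) => //.
move=> i; case: ifP => _.
  rewrite (_ : mkset _ = setT `&` (fun y : V => dotv (map_mx ratr q) (y : 'rV[R]_d))
    @^-1` `]-oo, 0[%classic).
    exact: mq.
  by apply/seteqP; split=> y /=; rewrite in_itv //= => -[].
rewrite (_ : mkset _ = setT `&` (fun y : V => dotv (map_mx ratr q) (y : 'rV[R]_d))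
  @^-1` `]0, +oo[%classic).
  exact: mq.
by apply/seteqP; split=> y /=; rewrite in_itv /= andbT // => -[].
Qed.

End TupleSpace.

(** * Joint law of the sample, sign changes and independence *)

Section Joint.
Context (R : realType) (d N : nat) disp (T : measurableType disp).
Local Notation V := (borel_rV R d).
Local Notation tuples J := (g_sigma_algebraType (@rectangles R d N J)).
Implicit Types (X : 'I_N -> {mfun T >-> V}) (J E : {set 'I_N}).

Definition joint X J : T -> tuples J := fun w i => X i w.

Lemma measurable_joint X J : measurable_fun setT (joint X J).
Proof. by apply: measurable_tuple => i; exact: measurable_funPT. Qed.

HB.instance Definition _ X J :=
  isMeasurableFun.Build _ _ _ _ (joint X J) (@measurable_joint X J).

Definition flip (b : bool) (f : T -> V) : T -> V :=
  fun w => if b then - (f w : 'rV[R]_d) else f w.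

Lemma measurable_flip b (f : {mfun T >-> V}) : measurable_fun setT (flip b f).
Proof.
rewrite /flip; case: b; last exact: measurable_funPT.
by apply: (measurableT_comp (@measurable_oppv R d)); exact: measurable_funPT.
Qed.

HB.instance Definition _ b (f : {mfun T >-> V}) :=
  isMeasurableFun.Build _ _ _ _ (flip b f) (measurable_flip b f).

Definition flips E X i : {mfun T >-> V} := flip (i \in E) (X i).

End Joint.

Section IID.
Context (R : realType) (d N : nat) disp (T : measurableType disp).
Local Notation V := (borel_rV R d).
Local Notation tuples J := (g_sigma_algebraType (@rectangles R d N J)).
Context (P : probability T R) (phi : probability V R).
Context (X : 'I_N -> {RV P >-> V}).
Hypothesis iid : iid_sample phi X.
Implicit Types (J E : {set 'I_N}).

Lemma iid_rectangle J (A : 'I_N -> set V) : (forall i, measurable (A i)) ->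
  P (joint X J @^-1` rectangle J A) = (\prod_(i in J) phi (A i))%E.
Proof.
move=> mA; rewrite preimage_rectangle iid.2 //.
by apply: eq_bigr => i _; rewrite -(iid.1 i _ (mA i)).
Qed.

(** The sign change is moved from the variables to the sides of the rectangle, where evenness of
    [phi] absorbs it. *)
Lemma flips_rectangle E J (A : 'I_N -> set V) :
  even_measure phi -> (forall i, measurable (A i)) ->
  P (joint (flips E X) J @^-1` rectangle J A) = (\prod_(i in J) phi (A i))%E.
Proof.
move=> ev mA.
pose B i : set V := if i \in E then [set - (y : 'rV[R]_d) | y in A i] else A i.
have oppE (C : set V) : [set - (y : 'rV[R]_d) | y in C] =
                        (fun y : V => - (y : 'rV[R]_d) : V) @^-1` C.
  apply/seteqP; split=> y /=; first by move=> [z Cz <-]; rewrite opprK.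
  by move=> Cy; exists (- (y : 'rV[R]_d)); rewrite ?opprK.
have mB i : measurable (B i).
  rewrite /B; case: ifP => // _; rewrite oppE -[X in measurable X]setTI.
  exact: measurable_oppv.
transitivity (P (joint X J @^-1` rectangle J B)).
  congr (P _); apply/seteqP; split=> w /= wA i iJ; move: (wA i iJ);
    by rewrite /joint /flips /= /flip /B; case: (i \in E) => //; rewrite oppE.
rewrite iid_rectangle //; apply: eq_bigr => i _; rewrite /B.
by case: ifP => // _; exact: ev.
Qed.

(** Both joint laws agree on rectangles, which are stable under intersection and generate the
    sigma-algebra. *)
Lemma sign_invariance E (B : set (tuples [set: 'I_N]%SET)) :
  even_measure phi -> measurable B ->
  P (joint (flips E X) [set: 'I_N]%SET @^-1` B) = P (joint X [set: 'I_N]%SET @^-1` B).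
Proof.
move=> ev mB; pose J := [set: 'I_N]%SET.
apply: (@measure_unique _ R (tuples J) (rectangles J) (fun=> setT) erefl
  (@rectangles_setI R d N J) (fun=> @rectangles_setT R d N J) _
  (distribution P (joint (flips E X) J)) (distribution P (joint X J))) => //.
- by rewrite bigcup_const.
- move=> _ [A mA ->]; rewrite /distribution /pushforward.
  by rewrite [LHS]flips_rectangle // [RHS]iid_rectangle.
- by move=> _; apply: (le_lt_trans (probability_le1 _ _)); rewrite ?ltry.
Qed.

Lemma joint_independent J i (B : set (tuples J)) (C : set V) :
  i \notin J -> measurable B -> measurable C ->
  P ((joint X J @^-1` B) `&` (X i @^-1` C)) = (P (joint X J @^-1` B) * phi C)%E.
Proof.
move=> iJ mB mC.
have mXC : measurable (X i @^-1` C).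
  by rewrite -[X in measurable X]setTI; exact: measurable_funPT.
(* For fixed [C] both sides are finite measures in [B]: [m1] is the law of the tuple on the event
   that [X i] lies in [C], and [m2] is the law of the tuple scaled by [phi C]. It suffices to
   compare them on rectangles. *)
pose m1 := pushforward (mrestr P mXC) (joint X J).
have c0 : (0 <= fine (phi C))%R by rewrite fine_ge0.
pose m2 : {measure set (tuples J) -> \bar R} := mscale (NngNum c0) (distribution P
  (joint X J)).
have phiC : phi C = (fine (phi C))%:E by rewrite fineK // fin_num_measure.
rewrite muleC phiC.
apply: (@measure_unique _ R (tuples J) (rectangles J) (fun=> setT) erefl
  (@rectangles_setI R d N J) (fun=> @rectangles_setT R d N J) _
  [the measure _ _ of m1] m2) => //.
- by rewrite bigcup_const.
- move=> _ [A mA ->]; rewrite /m1 /m2 /= /pushforward /mrestr /mscale /= -phiC.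
  rewrite /distribution /pushforward [X in (_ * X)%E]iid_rectangle //.
  (* With [C] as its side at [i], the intersection becomes a rectangle over [i |: J]. *)
  pose A' j := if j == i then C else A j.
  have mA' j : measurable (A' j) by rewrite /A'; case: ifP.
  have -> : joint X J @^-1` rectangle J A `&` X i @^-1` C =
            joint X (i |: J) @^-1` rectangle (i |: J) A'.
    apply/seteqP; split=> w /=.
      move=> [wA wC] j; rewrite /A' !inE; case: eqP => [->//|_] /= jJ; exact: wA.
    move=> wA; split; last by have := wA i (setU11 _ _); rewrite /A' eqxx.
    move=> j jJ; have := wA j; rewrite /A' !inE jJ orbT => /(_ isT).
    by have /negPf-> : j != i by apply: contraNneq iJ => <-.
  rewrite iid_rectangle // big_setU1 //= /A' eqxx; congr (_ * _)%E.
  apply: eq_bigr => j jJ.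
  by have /negPf-> : j != i by apply: contraNneq iJ => <-.
- move=> _; rewrite /m1 /= /pushforward /mrestr.
  rewrite preimage_setT setTI.
  exact: le_lt_trans (probability_le1 P mXC) (ltry _).
Qed.

(** By independence the pair has the product law, whose value at [D] is an integral over sections.
    This allows conditioning on all points but one. *)
Lemma joint_product J i (D : set (V * tuples J)) : i \notin J -> measurable D ->
  P [set w | D (X i w, joint X J w)] =
  (\int[distribution P (joint X J)]_y phi (ysection D y))%E.
Proof.
move=> iJ mD; pose XJ w : V * tuples J := (X i w, joint X J w).
have mXJ : measurable_fun setT XJ by apply: measurable_fun_pair; exact: measurable_funPT.
pose XJm : {mfun T >-> (V * tuples J)%type} :=
  HB.pack XJ (isMeasurableFun.Build _ _ _ _ XJ mXJ).
rewrite -[RHS]/((phi \x^ distribution P (joint X J)) D)%E.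
rewrite -[LHS]/(distribution P XJm D).
rewrite -(@product_measure_unique _ _ _ _ R phi (distribution P (joint X J))
  (distribution P XJm)) //.
  by apply: product_measure_unique => //= A B mA mB; rewrite product_measure2E.
move=> A B mA mB; rewrite muleC -(joint_independent iJ mB mA).
by rewrite setIC.
Qed.

End IID.

(** * General position almost surely *)

Section Gram.
Context (R : realType) (d : nat).
Implicit Types m : nat.

(** The Gram determinant vanishes exactly when the vectors are dependent; as a polynomial in their
    coordinates it makes dependence a measurable event. *)
Definition gram m (v : 'I_m -> 'rV[R]_d) : R :=
  \det (\matrix_(a, b) dotv (v a) (v b)).

Lemma dotv_mulmx (u x : 'rV[R]_d) : dotv u x = (u *m x^T) 0 0.
Proof. by rewrite mxE; apply: eq_bigr => i _; rewrite mxE. Qed.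

Lemma gram_mxE m (v : 'I_m -> 'rV[R]_d) :
  \matrix_(a, b) dotv (v a) (v b) = (\matrix_a v a) *m (\matrix_a v a)^T.
Proof.
by apply/matrixP => a b; rewrite !mxE; apply: eq_bigr => i _; rewrite !mxE.
Qed.

(** If [c] annihilates the Gram matrix from the left, then the combination with coefficients [c] has
    squared norm 0. *)
Lemma gram_eq0_dependent m (v : 'I_m -> 'rV[R]_d) : gram v = 0 ->
  exists2 c : 'rV[R]_m, c != 0 & \sum_a c 0 a *: v a = 0.
Proof.
move=> /eqP/det0P[c c0]; rewrite gram_mxE => cV; exists c => //.
have -> : \sum_a c 0 a *: v a = c *m (\matrix_a v a).
  by rewrite mulmx_sum_row; apply: eq_bigr => a _; rewrite rowK.
apply: dotvv_eq0; rewrite dotv_mulmx trmx_mul mulmxA -(mulmxA c) cV.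
by rewrite mul0mx mxE.
Qed.

(** The rows of the inverse Gram matrix times the matrix of the vectors form the dual basis of their
    span. *)
Lemma gram_neq0_dual m (v : 'I_m -> 'rV[R]_d) a : gram v != 0 ->
  exists u, forall b, dotv u (v b) = (a == b)%:R.
Proof.
move=> g0; set M : 'M[R]_(m, d) := \matrix_a v a.
have U : M *m M^T \in unitmx by rewrite unitmxE unitfE -gram_mxE.
exists (delta_mx 0 a *m invmx (M *m M^T) *m M) => b.
have -> : v b = row b M by rewrite rowK.
rewrite dotv_mulmx tr_row colE mulmxA -(mulmxA _ M) -(mulmxA (delta_mx 0 a)) mulVmx
  // mulmx1.
by rewrite mul_delta_mx_cond; case: eqP => _; rewrite !mxE ?eqxx.
Qed.

Lemma exists_orthogonal m (v : 'I_m -> 'rV[R]_d) : (m < d)%N ->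
  exists2 u, u != 0 & forall a, dotv u (v a) = 0.
Proof.
move=> md; set M : 'M[R]_(d, m) := (\matrix_a v a)^T.
have : kermx M != 0.
  by rewrite kermx_eq0 /row_free neq_ltn (leq_ltn_trans (rank_leq_col M)).
move=> /rowV0Pn[u /sub_kermxP uM u0]; exists u => // a.
have := congr1 (fun B : 'rV[R]_m => B 0 a) uM; rewrite !mxE => uMa.
by rewrite -[RHS]uMa; apply: eq_bigr => i _; rewrite !mxE.
Qed.

Lemma measurable_gram disp (T : measurableType disp) m
    (v : 'I_m -> T -> borel_rV R d) :
  (forall a, measurable_fun setT (v a)) ->
  measurable_fun setT (fun t => gram (fun a => (v a t : 'rV[R]_d))).
Proof.
move=> mv; rewrite /gram /determinant; apply: measurable_sum => s.
apply: measurable_funM => //; apply: measurable_prod => a _.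
under eq_fun do rewrite mxE.
exact: measurable_dotv.
Qed.

Definition consv m (z : 'rV[R]_d) (v : 'I_m -> 'rV[R]_d) (a : 'I_m.+1) : 'rV[R]_d :=
  if unlift ord0 a is Some b then v b else z.

(** In a linear relation between [z] and the independent vectors [v] the coefficient of [z] cannot
    be 0, so [z] lies in their span. *)
Lemma gram_consv_orthogonal m (v : 'I_m -> 'rV[R]_d) u z :
  gram v != 0 -> gram (consv z v) = 0 -> (forall a, dotv u (v a) = 0) ->
  dotv u z = 0.
Proof.
move=> gv /gram_eq0_dependent[c c0]; rewrite big_ord_recl /consv unlift_none.
under eq_bigr do rewrite liftK; move=> cz uv.
have cz0 : c 0 ord0 != 0.
  apply: contraNneq c0 => c00; apply/eqP/rowP => a; rewrite mxE.
  case: (unliftP ord0 a) => [b|] -> //.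
  have [w wv] := gram_neq0_dual b gv.
  have := congr1 (dotv w) cz; rewrite c00 scale0r add0r dotv_sumr.
  rewrite (bigD1 b) //= dotvZr wv eqxx mulr1 big1 ?addr0 => [->|a' ab].
    by rewrite dotvC dotv0l.
  by rewrite dotvZr wv eq_sym (negPf ab) mulr0.
have := congr1 (dotv u) cz; rewrite dotvC dotvDl dotvC dotvZr [dotv _ u]dotvC dotv_sumr.
rewrite big1 ?addr0 => [|a _]; last by rewrite dotvZr uv mulr0.
rewrite [dotv u 0]dotvC dotv0l => /eqP.
by rewrite mulf_eq0 (negPf cz0) => /eqP.
Qed.

End Gram.

Section AlmostSureGeneralPosition.
Context (R : realType) (d N : nat) disp (T : measurableType disp).
Local Notation V := (borel_rV R d).
Context (P : probability T R) (phi : probability V R).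
Context (X : 'I_N -> {RV P >-> V}).
Hypotheses (iid : iid_sample phi X) (hyp : null_on_hyperplanes phi).

(** The functional dual to [x i] in the family formed by [i] and [S] is the one required. *)
Lemma gram_gp (x : 'I_N -> 'rV[R]_d) :
  (forall m (f : {ffun 'I_m -> 'I_N}), injective f -> (m <= d)%N ->
    gram (x \o f) != 0) -> general_position x.
Proof.
move=> gx S i iS Sd; pose s := i :: enum S.
have us : uniq s by rewrite /= mem_enum iS enum_uniq.
have ss : size s = #|S|.+1 by rewrite /= -cardE.
pose f : {ffun 'I_(#|S|.+1) -> 'I_N} := [ffun a => nth i s (a : 'I_(#|S|.+1))].
have injf : injective f.
  move=> a b; rewrite !ffunE => /eqP; rewrite nth_uniq ?ss ?ltn_ord // => /eqP.
  exact: val_inj.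
have [u ux] := gram_neq0_dual (ord0 : 'I_(#|S|.+1)) (gx _ f injf Sd).
exists u => [j jS|].
  have js : j \in s by rewrite inE mem_enum jS orbT.
  have jl : (index j s < #|S|.+1)%N by rewrite -ss index_mem.
  have := ux (Ordinal jl); rewrite /= ffunE /= nth_index // => ->.
  have ij : i != j by apply: contraNneq iS => ->.
  by rewrite -(inj_eq val_inj) /= (negPf ij).
by have := ux ord0; rewrite /= ffunE /= => ->; exact: oner_neq0.
Qed.

(** Induction on the number of points: almost surely the last [m] are independent, and given them
    the first point must avoid a null set. *)
Lemma gram_null m (f : 'I_m -> 'I_N) : injective f -> (m <= d)%N ->
  P [set w | gram (fun a => (X (f a) w : 'rV[R]_d)) = 0] = 0%E.
Proof.
have mg m' (f' : 'I_m' -> 'I_N) :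
    measurable [set w | gram (fun a => (X (f' a) w : 'rV[R]_d)) = 0].
  rewrite (_ : mkset _ = setT `&`
    (fun w => gram (fun a => (X (f' a) w : 'rV[R]_d))) @^-1` [set 0]).
    by apply: measurable_gram => // a; exact: measurable_funPT.
  by rewrite setTI.
elim: m f => [|m IH] f injf md.
  rewrite (_ : mkset _ = set0) ?measure0 //; apply/seteqP; split => w //=.
  by rewrite /gram det_mx00 => /eqP; rewrite oner_eq0.
pose g b := f (lift ord0 b); pose i := f ord0.
have injg : injective g by move=> a b /injf/lift_inj.
pose J := [set g b | b : 'I_m]%SET.
have iJ : i \notin J.
  by apply/imsetP => -[b _ /injf/eqP]; rewrite (negPf (neq_lift _ _)).
have gJ b : g b \in J by exact: imset_f.
pose tup := g_sigma_algebraType (@rectangles R d N J).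
(* [D] is the event that the points indexed by [g] are independent while the additional point makes
   the family dependent. *)
pose D : set (V * tup) := [set zy |
  gram (fun a => (zy.2 : 'I_N -> 'rV[R]_d) (g a)) != 0 /\
  gram (consv (zy.1 : 'rV[R]_d) (fun a => (zy.2 : 'I_N -> 'rV[R]_d) (g a))) = 0].
have mev b : measurable_fun setT
    (fun zy : V * tup => (zy.2 : 'I_N -> 'rV[R]_d) (g b) : V).
  apply: (measurableT_comp (measurable_eval (gJ b))); exact: measurable_snd.
have mD : measurable D.
  rewrite (_ : D = (setT `&` (fun zy : V * tup =>
        gram (fun a => (zy.2 : 'I_N -> 'rV[R]_d) (g a))) @^-1` (~` [set 0])) `&`
      (setT `&` (fun zy : V * tup => gram (consv (zy.1 : 'rV[R]_d)
        (fun a => (zy.2 : 'I_N -> 'rV[R]_d) (g a)))) @^-1` [set 0])); last first.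
    apply/seteqP; split=> zy /=; first by move=> [/eqP ? ?].
    by move=> [[_ ?] [_ ?]]; split => //; apply/eqP.
  apply: measurableI.
    by apply: (measurable_gram (v := fun a (zy : V * tup) => _)) => //;
      exact: measurableC.
  apply: (measurable_gram (v := fun a (zy : V * tup) => consv (zy.1 : 'rV[R]_d) _ a))
    => // a.
  rewrite /consv; case: unliftP => [b _|_]; [exact: mev|exact: measurable_fst].
apply: (@subset_measure0 _ _ _ P _ ([set w | gram (fun a => (X (g a) w : 'rV[R]_d)) =
  0] `|`
   [set w | D (X i w, joint X J w)])) => //.
- apply: measurableU => //; rewrite -[X in measurable X]setTI.
  by apply: (measurable_fun_pair (f := X i) (g := joint X J)) => //;
    exact: measurable_funPT.
- move=> w /= fw; have [|gw] := eqVneq (gram (fun a => (X (g a) w : 'rV[R]_d))) 0;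
  first by left.
  right; split => //=; rewrite -[RHS]fw; congr (gram _); apply/funext => a.
  by rewrite /consv; case: unliftP => [b|] ->.
have D0 : P [set w | D (X i w, joint X J w)] = 0%E.
  rewrite (joint_product iid iJ mD); apply: integral0_eq => y _.
  (* Fewer than [d] points have a common normal [u], and the section of [D] lies in the hyperplane
     orthogonal to [u], which has measure 0. *)
  have [u u0 uy] := exists_orthogonal (fun a => (y : 'I_N -> 'rV[R]_d) (g a)) md.
  apply: (subset_measure0 _ _ _ (hyp u0)) => //.
  - exact: measurable_ysection.
  - rewrite (_ : mkset _ = setT `&` (fun x : V => dotv u (x : 'rV[R]_d)) @^-1` [set 0]).
      by apply: (@measurable_dotv _ _ _ _ (cst _) id).
    by rewrite setTI.
  by move=> z; rewrite /ysection /= inE => -[g0 gz];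
    apply: gram_consv_orthogonal g0 gz uy.
apply/eqP; rewrite -measure_le0.
apply: (le_trans (measureU2 _ _ _)) => //.
  rewrite -[X in measurable X]setTI.
  by apply: (measurable_fun_pair (f := X i) (g := joint X J)) => //;
    exact: measurable_funPT.
rewrite (_ : (_ + _)%E = (0 + 0)%E); first by rewrite adde0.
apply: f_equal2; [exact: IH (ltnW md)|exact: D0].
Qed.

(** There are finitely many index families of length at most [d]. The exceptional set is an explicit
    measurable set, so the event of general position itself need not be shown measurable. *)
Lemma ae_general_position : exists Z, [/\ measurable Z, P Z = 0%E
  & forall w, ~ Z w -> general_position (fun i => (X i w : 'rV[R]_d))].
Proof.
(* A family with a repeated index always has Gram determinant 0 and is replaced by the empty set. *)
pose F (mf : {m : 'I_d.+1 & {ffun 'I_m -> 'I_N}}) : set T :=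
  if `[< injective (tagged mf) >] then
    [set w | gram (fun a => (X (tagged mf a) w : 'rV[R]_d)) = 0] else set0.
have mF mf : measurable (F mf).
  rewrite /F; case: ifP => // _.
  rewrite (_ : mkset _ = setT `&`
    (fun w => gram (fun a => (X (tagged mf a) w : 'rV[R]_d))) @^-1` [set 0]).
    by apply: measurable_gram => // a; exact: measurable_funPT.
  by rewrite setTI.
have [mU U0] : measurable (\big[setU/set0]_mf F mf) /\ P (\big[setU/set0]_mf F mf) = 0%E.
  apply: (big_ind (fun A => measurable A /\ P A = 0%E)) => [|A B [mA A0] [mB B0]|mf _].
  - by split; [exact: measurable0|exact: measure0].
  - by split; [exact: measurableU|rewrite measureU0].
  - split=> //; rewrite /F; case: asboolP => [injf|_]; last exact: measure0.
    by rewrite gram_null // -ltnS ltn_ord.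
exists (\big[setU/set0]_mf F mf); split=> // w Zw; apply: gram_gp => m f injf md.
apply/eqP => g0; apply: Zw.
pose mf : {m : 'I_d.+1 & {ffun 'I_m -> 'I_N}} :=
  Tagged (fun m : 'I_d.+1 => {ffun 'I_m -> 'I_N}) (i := Ordinal (md : (m < d.+1)%N)) f.
rewrite (bigD1 mf) //=; left; rewrite /F.
by have /asboolP -> : injective (tagged mf) by exact: injf.
Qed.

End AlmostSureGeneralPosition.

(** * Expected number of faces *)

Section AllSigns.
Context (R : realType) (d N : nat).
Implicit Types (x : 'I_N -> 'rV[R]_d) (S T E F : {set 'I_N}).

Lemma realizes_flip x S T E F :
  realizes (fun i => if i \in F then - x i else x i) S T E <->
  realizes x S T (finset.setU (E :\: F) (F :\: E)).
Proof.
have dn u i : dotv u (- x i) = - dotv u (x i) by rewrite -scaleN1r dotvZr mulN1r.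
split=> -[u uS uT]; exists u => i.
- by move=> /uS; case: ifP => // _; rewrite dn => /eqP; rewrite oppr_eq0 => /eqP.
- move=> /uT; rewrite !inE; case: (i \in F); case: (i \in E) => //=;
    by rewrite dn ?oppr_gt0 ?oppr_lt0.
- by move=> /uS ui; case: ifP => // _; rewrite dn ui oppr0.
- move=> /uT; rewrite !inE; case: (i \in F); case: (i \in E) => //=;
    by rewrite dn ?oppr_gt0 ?oppr_lt0.
Qed.

Lemma realizes_congr x S T E F : (forall i, i \in T -> (i \in E) = (i \in F)) ->
  realizes x S T E -> realizes x S T F.
Proof. by move=> EF [u uS uT]; exists u => // i iT; rewrite -EF //; exact: uT. Qed.

(** Zeros at the points of [S] are possible iff all choices of signs there are; this iterates
    [realizes_setU1l] over the elements of [S]. *)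
Lemma realizes_setU x S T E : general_position x ->
  (forall i, i \in S -> i \notin T) -> (#|S| <= d)%N ->
  realizes x S T E <->
  forall F, (forall i, i \in T -> (i \in F) = (i \in E)) ->
    realizes x finset.set0 (S :|: T) F.
Proof.
move=> gp; elim: {S}_.+1 {-2}S T E (ltnSn #|S|) => // n IH S T E Sn ST Sd.
have [S0|[i iS]] := set_0Vmem S.
  rewrite S0 finset.set0U; split=> [rE F FE|/(_ E)]; last by apply.
  by apply: realizes_congr rE => i iT; rewrite FE.
have iT := ST i iS.
have Sn' : (#|S :\ i| < n)%N by rewrite (cardsD1 i S) iS in Sn; rewrite -ltnS.
have Sd' : (#|S :\ i| < d)%N by rewrite (cardsD1 i S) iS in Sd.
have ST' j : j \in S :\ i -> j \notin i |: T.
  by rewrite !inE => /andP[/negPf-> /ST].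
have ST_ : S :\ i :|: (i |: T) = S :|: T.
  by rewrite finset.setUA [_ :|: [set i]%SET]finset.setUC finset.setD1K.
have iT' j : j \in T -> j != i by move=> jT; apply: contraNneq iT => <-.
rewrite -{1}(finset.setD1K iS) realizes_setU1l ?finset.setD11 //.
rewrite IH ?(ltnW Sd') // [X in _ /\ X]IH ?(ltnW Sd') // ST_.
split.
  move=> [h1 h2] F FE; have [iF|iF] := boolP (i \in F).
    apply: h2 => j; rewrite !inE; case: eqVneq => [->|] //= ji jT.
    by rewrite FE.
  apply: h1 => j; rewrite !inE; case: eqVneq => [->|ji] /= jT; first exact: negPf.
  by rewrite FE.
move=> h; split=> F FE; apply: h => j jT.
  by rewrite FE !inE ?jT ?orbT // iT'.
by rewrite FE !inE ?jT ?orbT // (negPf (iT' j jT)).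
Qed.

(* In general position this is [realizes x S (~: S) E], expressed through full
   sign patterns only, which makes it measurable. *)
Definition allsigns S E : set ('I_N -> 'rV[R]_d) :=
  [set x | forall F, (forall i, i \notin S -> (i \in F) = (i \in E)) ->
             realizes x finset.set0 [set: 'I_N]%SET F].

Lemma allsignsP x S E : general_position x -> (#|S| <= d)%N ->
  realizes x S (~: S) E <-> allsigns S E x.
Proof.
move=> gp Sd; rewrite realizes_setU // => [|i]; last by rewrite !inE negbK.
rewrite finset.setUCr; split=> h F FE; apply: h => i.
  by rewrite inE; exact: FE.
by move=> iS; apply: FE; rewrite inE.
Qed.

Lemma allsigns_flip x S F :
  allsigns S finset.set0 (fun i => if i \in F then - x i else x i) <->
  allsigns S F x.
Proof.
split=> h G GE.
  have /h/realizes_flip : forall i, i \notin S ->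
      (i \in finset.setU (G :\: F) (F :\: G)) = (i \in finset.set0).
    by move=> i /GE; rewrite !inE => ->; case: (i \in F).
  apply: realizes_congr => i _; rewrite !inE.
  by case: (i \in F); case: (i \in G).
apply/realizes_flip/h => i /GE; rewrite !inE => ->.
by case: (i \in F).
Qed.

Lemma measurable_allsigns S E :
  measurable (allsigns S E
    : set (g_sigma_algebraType (@rectangles R d N [set: 'I_N]%SET))).
Proof.
rewrite (_ : allsigns S E =
  \bigcap_(F in [set F : {set 'I_N} | forall i, i \notin S -> (i \in F) = (i \in E)])
     [set x | realizes x finset.set0 [set: 'I_N]%SET F]); last first.
  by apply/seteqP; split=> x /=.
by apply: fin_bigcap_measurable => [|F _];
  [exact: finite_finset|exact: measurable_realizesT].
Qed.

End AllSigns.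

Section NullSets.
Import HBNNSimple.
Local Open Scope ereal_scope.
Context d (T : measurableType d) (R : realType) (mu : {measure set T -> \bar R}).

(* Applied to the number of faces, which is not known to be measurable on the
   null set where general position fails. *)
Lemma ge0_integral_null (f g : T -> \bar R) (Z : set T) :
  measurable Z -> mu Z = 0 -> (forall x, 0 <= f x) -> (forall x, 0 <= g x) ->
  (forall x, ~ Z x -> f x = g x) -> \int[mu]_x f x = \int[mu]_x g x.
Proof.
move=> mZ Z0.
suff le_int (f' g' : T -> \bar R) : (forall x, 0 <= f' x) -> (forall x, 0 <= g' x) ->
    (forall x, ~ Z x -> f' x = g' x) -> \int[mu]_x f' x <= \int[mu]_x g' x.
  move=> f0 g0 fg; apply/eqP; rewrite eq_le !le_int // => x Zx.
  by rewrite fg.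
move=> f0 g0 fg; rewrite ge0_integralE; last by move=> x _; exact: f0.
apply: ge_ereal_sup => _ [h hf <-].
have mCZ : measurable (~` Z) by exact: measurableC.
rewrite [leRHS]ge0_integralE; last by move=> x _; exact: g0.
(* A simple function below [f'], set to 0 on [Z], lies below [g'] and keeps its integral. *)
apply: ereal_sup_ubound; exists (proj_nnsfun h mCZ).
  move=> x; rewrite -mrestrict patch_setT /patch; case: ifPn => xZ; last exact: g0.
  by rewrite -fg; [have := hf x; rewrite patch_setT|move: xZ; rewrite inE].
rewrite -mrestrict -integral_nnsfun // -setTD -ge0_negligible_integral //.
- by rewrite integral_nnsfun // patch_setT.
- by apply/measurable_EFinP; exact: measurable_funPT.
- by move=> x _; rewrite lee_fin.
Qed.

End NullSets.

Section ExpectedFaces.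
Context (R : realType) (d N : nat) disp (T : measurableType disp).
Local Notation V := (borel_rV R d).
Local Notation tuples := (g_sigma_algebraType (@rectangles R d N [set: 'I_N]%SET)).
Context (P : probability T R) (phi : probability V R).
Context (X : 'I_N -> {RV P >-> V}).
Hypotheses (iid : iid_sample phi X) (hyp : null_on_hyperplanes phi)
           (ev : even_measure phi).
Implicit Types S E F : {set 'I_N}.

Let pr S E := P (joint X [set: 'I_N]%SET @^-1` allsigns S E).

Let mpr S E : measurable (joint X [set: 'I_N]%SET @^-1` allsigns S E).
Proof.
rewrite -[X in measurable X]setTI; apply: measurable_funPT => //.
exact: measurable_allsigns.
Qed.

(** Changing the signs of the points in [E] turns the pattern [E] into the all-positive one and
    preserves the joint law. *)
Lemma probability_allsigns S E : pr S E = pr S finset.set0.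
Proof.
rewrite /pr -[RHS](sign_invariance iid E ev (measurable_allsigns _ _)).
congr (P _); apply/seteqP; split=> w /=; rewrite /joint /flips /flip.
  by move=> /allsigns_flip.
by move=> h; apply/allsigns_flip.
Qed.

(** The left side is the expected number of patterns off [S] realizable with zeros on [S]; almost
    surely this number is the constant on the right. *)
Lemma sum_probability_allsigns S : (#|S| <= d)%N ->
  (\sum_(E in powerset (~: S)) pr S E = (regions (d - #|S|) (N - #|S|))%:R%:E)%E.
Proof.
move=> Sd; have [Z [mZ Z0 gpZ]] := ae_general_position iid hyp.
transitivity (\int[P]_w (\sum_(E in powerset (~: S))
    \1_(joint X [set: 'I_N]%SET @^-1` allsigns S E) w)%:E)%E.
  under eq_integral do rewrite -sumEFin big_mkcond /=.
  rewrite ge0_integral_sum //; last 2 first.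
  - by move=> E; case: (E \in powerset (~: S)) => //; apply/measurable_EFinP;
    exact: measurable_indic.
  - by move=> E w _; case: (E \in powerset (~: S)) => //; rewrite lee_fin.
  rewrite big_mkcond; apply: eq_bigr => E _; case: (E \in powerset (~: S)).
    by rewrite integral_indic // setIT.
  by rewrite integral0.
rewrite (ge0_integral_null (g := cst (regions (d - #|S|) (N - #|S|))%:R%:E) mZ Z0).
- rewrite integral_cst // -[RHS]mule1; congr (_ * _)%E.
  exact: probability_setT.
- by move=> w; rewrite lee_fin sumr_ge0.
- by move=> w; rewrite lee_fin.
move=> w /gpZ gp /=; congr EFin.
have -> : (N - #|S|)%N = #|~: S| by rewrite [RHS]cardsCs finset.setCK card_ord.
rewrite -(card_sign_sets gp) // => [|i]; last by rewrite inE negbK.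
rewrite -sum1_card natr_sum big_mkcond [RHS]big_mkcond /=; apply: eq_bigr => E _.
rewrite !inE; case: (E \subset ~: S) => //=; rewrite indicE.
case: asboolP => [/(allsignsP _ gp Sd) h|h]; first by rewrite mem_set.
by rewrite memNset // => /(allsignsP _ gp Sd).
Qed.

Lemma probability_face S : (#|S| <= d)%N ->
  pr S finset.set0 = ((regions (d - #|S|) (N - #|S|))%:R / 2 ^+ (N - #|S|))%:E.
Proof.
move=> Sd; have := sum_probability_allsigns Sd.
under eq_bigr do rewrite probability_allsigns.
have fp : pr S finset.set0 \is a fin_num by exact: fin_num_measure.
rewrite -(fineK fp) sumEFin sumr_const card_powerset => -[].
have -> : #|~: S| = (N - #|S|)%N by rewrite cardsCs finset.setCK card_ord.
move=> <-; congr EFin; rewrite -[X in X / _]mulr_natr natrX mulfK //.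
Qed.

Lemma expected_facesE k : (k < d)%N ->
  expected_faces X k =
  ('C(N, k)%:R * ((regions (d - k) (N - k))%:R / 2 ^+ (N - k)))%:E.
Proof.
move=> kd; have [Z [mZ Z0 gpZ]] := ae_general_position iid hyp.
rewrite /expected_faces unlock.
(* Off the null set the number of faces is a sum of indicators of measurable events, whose
   expectation is computed termwise. *)
rewrite (ge0_integral_null (g := fun w => (\sum_(S : {set 'I_N} | #|S| == k)
    \1_(joint X [set: 'I_N]%SET @^-1` allsigns S finset.set0) w)%:E) mZ Z0).
- under eq_integral do rewrite -sumEFin big_mkcond /=.
  rewrite ge0_integral_sum //; last 2 first.
  + by move=> E; case: (#|E| == k) => //; apply/measurable_EFinP; exact: measurable_indic.
  + by move=> E w _; case: (#|E| == k) => //; rewrite lee_fin.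
  transitivity (\sum_(S : {set 'I_N} | #|S| == k)
      ((regions (d - k) (N - k))%:R / 2 ^+ (N - k) : R)%:E)%E.
    rewrite [RHS]big_mkcond; apply: eq_bigr => S _; case: (eqVneq #|S| k) => [Sk|_].
      rewrite integral_indic // setIT -[LHS]/(pr S finset.set0) probability_face Sk //.
      exact: ltnW.
    by rewrite integral0.
  rewrite sumEFin sumr_const; congr EFin; rewrite -[LHS]mulr_natl; congr (_%:R * _).
  by rewrite -[in RHS](card_ord N) -card_draws -cardsE; apply: eq_card => S; rewrite !inE.
- by move=> w; rewrite lee_fin.
- by move=> w; rewrite lee_fin sumr_ge0.
move=> w /gpZ gp /=; congr EFin; rewrite /DT_cone num_faces_pos //.
rewrite -sum1_card natr_sum big_mkcond [RHS]big_mkcond /=; apply: eq_bigr => S _.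
rewrite !inE; case: eqP => //= Sk; rewrite indicE.
have Sd : (#|S| <= d)%N by rewrite Sk ltnW.
case: asboolP => [/(allsignsP _ gp Sd) h|h]; first by rewrite mem_set.
by rewrite memNset // => /(allsignsP _ gp Sd).
Qed.

End ExpectedFaces.

(** * Entropy estimate of binomial coefficients *)

Section Stirling.
Context (R : realType).
Implicit Types (x t : R) (n k : nat).

Lemma derive_ge0_nonneg (f f' : R -> R) (a x : R) :
  (forall t, a <= t -> is_derive t 1 f (f' t)) -> (forall t, a <= t -> 0 <= f' t) ->
  f a = 0 -> a <= x -> 0 <= f x.
Proof.
move=> fd f'0 fa ax; rewrite -fa.
have df t : a <= t -> derivable f t 1 by move=> /fd[].
apply: (@ger0_derive1_ndecry _ f a) => // [t|t|].
- by rewrite in_itv /= andbT => /ltW/df.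
- rewrite in_itv /= andbT => /ltW at_; rewrite derive1E.
  by have := fd _ at_ => /@derive_val ->; exact: f'0.
- by apply: derivable_within_continuous => t; rewrite in_itv /= andbT => /df.
Qed.

(** The midpoint rule for the integral of the convex function [t^-1]; the derivative of the
    difference is a square over a positive quantity. *)
Lemma ln_ge_midpoint t : 1 <= t -> 2 * (t - 1) / (t + 1) <= ln t.
Proof.
move=> t1; rewrite -subr_ge0.
have -> : ln t - 2 * (t - 1) / (t + 1) = ln t + (4 * (t + 1)^-1 - 2).
  by field; rewrite gt_eqF //; lra.
apply: (@derive_ge0_nonneg (fun t => ln t + (4 * (t + 1)^-1 - 2))
   (fun t => t^-1 - 4 * (t + 1) ^- 2) 1 t) => // [s s1|s s1|].
- have s0 : 0 < s by lra.
  have s2 : s + 1 != 0 by rewrite gt_eqF //; lra.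
  have h1 := is_derive1_ln s0.
  have h3 : is_derive s 1 (fun t : R => t + 1) (1 + 0) by exact: is_deriveD.
  have h2 : is_derive s 1 (fun t : R => (t + 1)^-1) (- (s + 1) ^- 2).
    by apply: (is_derive_eq (is_deriveV (f := fun t : R => t + 1) s2 h3));
      rewrite /GRing.scale /= addr0 mulr1.
  apply: is_derive_eq.
  by rewrite /GRing.scale /= subr0 mulrN.
- have s0 : 0 < s by lra.
  have -> : s^-1 - 4 * (s + 1) ^- 2 = (s - 1) ^+ 2 / (s * (s + 1) ^+ 2).
    by field; rewrite !gt_eqF //; lra.
  by rewrite divr_ge0 ?sqr_ge0 // mulr_ge0 ?sqr_ge0 ?ltW.
- by rewrite ln1; field.
Qed.

(** The trapezoidal rule for the same integral. *)
Lemma ln_le_trapezoid t : 1 <= t -> ln t <= (t - t^-1) / 2.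
Proof.
move=> t1; rewrite -subr_ge0.
apply: (@derive_ge0_nonneg (fun t => (t - t^-1) / 2 - ln t)
   (fun t => (1 - t^-1) ^+ 2 / 2) 1 t) => // [s s1|s s1|].
- have s0 : 0 < s by lra.
  have s2 : s != 0 by rewrite gt_eqF.
  have h1 := is_derive1_ln s0.
  have h2 : is_derive s 1 (fun t : R => t^-1) (- s ^- 2).
    apply: (is_derive_eq (is_deriveV (f := id) s2 _)).
    by rewrite /GRing.scale /= mulr1.
  apply: is_derive_eq.
  by rewrite /GRing.scale /=; field.
- by rewrite divr_ge0 ?sqr_ge0.
- by rewrite ln1 invr1; field.
Qed.

(** The logarithm of the ratio of [n!] to [n ^ (n + 1/2) * e ^ (- n)], which by Stirling's formula
    tends to [ln (2 * pi) / 2]; crude two-sided bounds suffice below. *)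
Definition stirling_dev n : R := ln n`!%:R - (n%:R + 2^-1) * ln n%:R + n%:R.

Lemma stirling_devS n :
  stirling_dev n.+1 - stirling_dev n.+2 =
  (n.+1%:R + 2^-1) * ln (n.+2%:R / n.+1%:R) - 1.
Proof.
rewrite /stirling_dev [n.+2`!]factS natrM lnM ?posrE ?ltr0n ?fact_gt0 //.
by rewrite ln_div ?posrE ?ltr0n // -[n.+2%:R]natr1; field.
Qed.

Lemma stirling_dev_bounds n : (0 < n)%N -> 3 / 4 <= stirling_dev n <= 1.
Proof.
case: n => // n _.
(* The sequence decreases by the midpoint bound. By the trapezoidal bound each decrease is at most
   the difference of consecutive terms [(4 * m)^-1], so the lower bound telescopes; at 1 it is an
   equality. *)
suff /andP[h1 ->] : 3 / 4 + (4 * n.+1%:R)^-1 <= stirling_dev n.+1 <= 1.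
  rewrite andbT (le_trans _ h1) // lerDl invr_ge0 mulr_ge0 //.
elim: n => [|n /andP[IH1 IH2]].
  have -> : stirling_dev 1 = 1 :> R.
    by rewrite /stirling_dev (_ : 1`! = 1)%N // ln1 mulr0 subrr add0r.
  by apply/andP; split; lra.
have := stirling_devS n; set D1 := stirling_dev n.+1 in IH1 IH2 *.
set D2 := stirling_dev n.+2 => E.
have n0 : 0 < n.+1%:R :> R by rewrite ltr0n.
have n2 : n.+2%:R = n.+1%:R + 1 :> R by rewrite -natr1.
move: n0 IH1 E; rewrite n2; move: (n.+1%:R : R) => m m0 IH1 E.
have t1 : 1 <= (m + 1) / m by rewrite ler_pdivlMr // mul1r lerDl.
have lo := ln_ge_midpoint t1; have up := ln_le_trapezoid t1.
have m00 : m != 0 by rewrite gt_eqF.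
have m10 : m + 1 != 0 by rewrite gt_eqF //; lra.
have mh : 0 < m + 2^-1 by lra.
have lo' : 1 <= (m + 2^-1) * ln ((m + 1) / m).
  apply: le_trans (ler_wpM2l (ltW mh) lo).
  rewrite le_eqVlt; apply/orP; left; apply/eqP; field.
  by rewrite m00 /= gt_eqF //; lra.
have up' : (m + 2^-1) * ln ((m + 1) / m) <= 1 + (4 * m)^-1 - (4 * (m + 1))^-1.
  apply: (le_trans (ler_wpM2l (ltW mh) up)).
  rewrite le_eqVlt; apply/orP; left; apply/eqP; field.
  by rewrite m00 m10.
by apply/andP; split; lra.
Qed.

Lemma ln_factE n : ln n`!%:R = (n%:R + 2^-1) * ln n%:R - n%:R + stirling_dev n.
Proof. by rewrite /stirling_dev; ring. Qed.

Lemma entropyE n k : (0 < k < n)%N ->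
  n%:R * entropy (k%:R / n%:R : R) =
  n%:R * ln n%:R - k%:R * ln k%:R - (n - k)%:R * ln (n - k)%:R.
Proof.
move=> /andP[k0 kn]; have n0 : (0 < n)%N by apply: leq_trans kn.
have nR : n%:R != 0 :> R by rewrite pnatr_eq0 -lt0n.
have -> : entropy (k%:R / n%:R : R) = - (k%:R / n%:R) * ln (k%:R / n%:R)
    - ((n - k)%:R / n%:R) * ln ((n - k)%:R / n%:R).
  rewrite /entropy (_ : 1 - k%:R / n%:R = (n - k)%:R / n%:R) //.
  by rewrite natrB ?(ltnW kn) //; field.
rewrite !ln_div ?posrE ?ltr0n ?subn_gt0 // natrB ?(ltnW kn) //.
by field.
Qed.

(** In the quotient of factorials the linear terms cancel, the halves of logarithms form the square
    root, and [c] collects the three Stirling deviations, each between 3/4 and 1. *)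
Lemma bin_entropyE n k : (0 < k < n)%N ->
  exists2 c : R, - (5 / 4) <= c <= - 2^-1 &
  'C(n, k)%:R = expR (n%:R * entropy (k%:R / n%:R))
                * Num.sqrt (n%:R / (k%:R * (n - k)%:R)) * expR c.
Proof.
move=> kn0; have /andP[k0 kn] := kn0; have n0 : (0 < n)%N by apply: leq_trans kn.
have nk0 : (0 < n - k)%N by rewrite subn_gt0.
exists (stirling_dev n - stirling_dev k - stirling_dev (n - k)).
  have /andP[? ?] := stirling_dev_bounds n0.
  have /andP[? ?] := stirling_dev_bounds k0.
  have /andP[? ?] := stirling_dev_bounds nk0.
  by apply/andP; split; lra.
have Q0 : 0 < n%:R / (k%:R * (n - k)%:R) :> R.
  by rewrite divr_gt0 ?mulr_gt0 ?ltr0n.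
have C0 : 0 < 'C(n, k)%:R :> R by rewrite ltr0n bin_gt0 ltnW.
rewrite -[LHS]lnK ?posrE //.
have -> : Num.sqrt (n%:R / (k%:R * (n - k)%:R)) =
    expR (2^-1 * ln (n%:R / (k%:R * (n - k)%:R))) :> R.
  by rewrite -powR12_sqrt ?ltW // /powR gt_eqF.
rewrite -!expRD; congr expR.
rewrite entropyE // ln_div ?posrE ?mulr_gt0 ?ltr0n // [ln (k%:R * _)]lnM ?posrE ?ltr0n //.
have /(congr1 (fun m => ln (m%:R : R))) := bin_fact (ltnW kn).
rewrite !natrM !lnM ?posrE ?mulr_gt0 ?ltr0n ?fact_gt0 ?bin_gt0 ?(ltnW kn) //.
rewrite !ln_factE => E.
have nkR : (n - k)%:R = n%:R - k%:R :> R by rewrite natrB // ltnW.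
move: E; rewrite nkR => E; lra.
Qed.

End Stirling.

(** * Binomial tails *)

Section Defect.
Context (R : realType).
Implicit Types (d N k m t : nat) (q : R).

(* The tail is dominated by a geometric series of ratio [q]. *)
Lemma binomial_tail_le t q j m : 0 <= q < 1 -> t%:R - m%:R <= q * m.+1%:R ->
  \sum_(i < j) 'C(t, m + i)%:R <= 'C(t, m)%:R / (1 - q) :> R.
Proof.
move=> /andP[q0 q1]; have q1' : 0 < 1 - q by rewrite subr_gt0.
elim: j m => [|j IH] m tm; first by rewrite big_ord0 divr_ge0 // ltW.
rewrite big_ord_recl addn0.
have tm' : t%:R - m.+1%:R <= q * m.+2%:R.
  by move: tm; rewrite -[m.+2%:R]natr1 -!natr1; nra.
have := IH _ tm'; under eq_bigr do rewrite addSnnS.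
(* Consecutive coefficients have ratio [(t - m) / (m + 1)], at most [q] by hypothesis. *)
have CS : 'C(t, m.+1)%:R <= q * 'C(t, m)%:R.
  have m0 : 0 < m.+1%:R :> R by rewrite ltr0n.
  have [mt|tm_] := leqP m t; last by rewrite !bin_small ?mulr0 // ltnW.
  have /(congr1 (fun n => n%:R : R)) := mul_bin_left t m.
  rewrite !natrM natrB // => E; rewrite -(ler_pM2l m0) E mulrCA mulrA.
  by rewrite ler_wpM2r.
move=> IH'; have -> : 'C(t, m)%:R / (1 - q) = 'C(t, m)%:R + q * 'C(t, m)%:R / (1 - q).
  by field; rewrite gt_eqF.
rewrite lerD2l (le_trans IH') // ler_pM2r // invr_gt0 //.
Qed.

(** The closed form of [face_defect], free of probability; [face_defectE] identifies the two. *)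
Definition defect d N k : R :=
  'C(N, k)%:R * (1 - (regions (d - k) (N - k))%:R / 2 ^+ (N - k)).

Lemma defectE d N k : (k < d)%N -> (d < N)%N ->
  defect d N k = 2 * 'C(N, k)%:R / 2 ^+ (N - k)
    * \sum_(i < N - d) 'C((N - k).-1, d - k + i)%:R.
Proof.
move=> kd dN; rewrite /defect.
have Nk : (N - k = (N - k).-1.+1)%N by rewrite prednK // subn_gt0 (ltn_trans kd).
set t := (N - k).-1 in Nk *; rewrite Nk regionsE.
have tdk : t.+1 = (d - k + (N - d))%N by rewrite -Nk; lia.
(* The row of Pascal's triangle with sum [2 ^ t] is split at [d - k]: the lower part is counted by
   [regions], the upper part is the tail. *)
have E : (2 ^ t.+1 = 2 * (\sum_(i < d - k) 'C(t, i) + \sum_(i < N - d) 'C(t, d - k +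
  i)))%N.
  rewrite expnS; congr (2 * _)%N; rewrite -[2%N]/(1 + 1)%N expnDn.
  under eq_bigr do rewrite !exp1n !muln1.
  by rewrite tdk big_split_ord.
have ER : 2 ^+ t.+1 = 2 * ((\sum_(i < d - k) 'C(t, i))%:R +
    \sum_(i < N - d) 'C(t, d - k + i)%:R) :> R.
  by rewrite -natrX E natrM natrD [X in _ + X]natr_sum.
have P0 : 2 ^+ t.+1 != 0 :> R by rewrite expf_neq0.
rewrite natrM; move: ER P0; set a := (\sum_(i < d - k) _)%:R; set b := \sum_(i < _) _.
move: (2 ^+ t.+1 : R) => p -> p0; field.
by move: p0; rewrite mulf_eq0 negb_or => /andP[].
Qed.

Lemma defect_gt0 d N k : (k < d)%N -> (d < N)%N -> 0 < defect d N k.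
Proof.
move=> kd dN; rewrite defectE // mulr_gt0 //.
  rewrite divr_gt0 ?exprn_gt0 // mulr_gt0 // ltr0n bin_gt0.
  by rewrite ltnW // (ltn_trans kd).
case: (N - d)%N (subn_gt0 d N) => [|n]; first by rewrite dN.
move=> _; rewrite big_ord_recl addn0 ltr_pwDl ?sumr_ge0 // ltr0n bin_gt0.
by lia.
Qed.

(* The square roots of Stirling's formula and the ratio [(N - d) / (N - k)],
   at [a = d / N] and [b = k / d], after extraction of the factor [1 / N]. *)
Definition prefactor (a b : R) : R :=
  (1 - a) / (1 - a * b) * Num.sqrt ((1 - a) * a * b * a * (1 - b))^-1.

(** Both sides are the multinomial coefficient with parts [k], [d - k] and [N - d]. *)
Lemma mul_bin_bin d N k : (k <= d)%N -> (d <= N)%N ->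
  ('C(N, k) * 'C(N - k, d - k) = 'C(N, d) * 'C(d, k))%N.
Proof.
move=> kd dN; have kN := leq_trans kd dN.
have F : (0 < k`! * (d - k)`! * (N - d)`!)%N by rewrite !muln_gt0 !fact_gt0.
apply/eqP; rewrite -(eqn_pmul2r F); apply/eqP.
have e1 := bin_fact kN; have e2 := bin_fact (leq_sub2r k dN).
have e3 := bin_fact dN; have e4 := bin_fact kd.
rewrite subnBA // subnK // in e2.
transitivity N`!; first by rewrite -e1 -e2; ring.
by rewrite -e3 -e4; ring.
Qed.

Lemma expR_mulG d N k : (0 < k)%N -> (k < d)%N -> (d < N)%N ->
  expR (- (N%:R * G (d%:R / N%:R) (k%:R / d%:R : R))) =
  2 ^+ (N - k) / expR (N%:R * entropy (d%:R / N%:R))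
               / expR (d%:R * entropy (k%:R / d%:R)).
Proof.
move=> k0 kd dN.
have NR : N%:R != 0 :> R by rewrite pnatr_eq0 -lt0n (leq_ltn_trans _ dN).
have dR : d%:R != 0 :> R by rewrite pnatr_eq0 -lt0n (leq_ltn_trans _ kd).
have -> : 2 ^+ (N - k) = expR ((N - k)%:R * ln 2) :> R.
  by rewrite expRM_natl lnK // posrE.
rewrite -!expRN -!expRD; congr expR; rewrite /G natrB; last first.
  by rewrite ltnW // (ltn_trans kd).
move: (ln 2) (entropy _) (entropy _) => l e1 e2; field.
by rewrite NR dR.
Qed.

Lemma prefactorE d N k : (0 < k)%N -> (k < d)%N -> (d < N)%N ->
  Num.sqrt (N%:R / (d%:R * (N - d)%:R)) * Num.sqrt (d%:R / (k%:R * (d - k)%:R))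
      * N%:R * ((N - d)%:R / (N - k)%:R) = prefactor (d%:R / N%:R) (k%:R / d%:R).
Proof.
move=> k0 kd dN; have kN := ltn_trans kd dN.
have NR : 0 < N%:R :> R by rewrite ltr0n (ltn_trans k0).
have dR : 0 < d%:R :> R by rewrite ltr0n (ltn_trans k0).
have kR : 0 < k%:R :> R by rewrite ltr0n.
have Nd : 0 < N%:R - d%:R :> R by rewrite subr_gt0 ltr_nat.
have dk : 0 < d%:R - k%:R :> R by rewrite subr_gt0 ltr_nat.
have Nk : 0 < N%:R - k%:R :> R by rewrite subr_gt0 ltr_nat.
rewrite !natrB ?(ltnW kd) ?(ltnW dN) ?(ltnW kN) // /prefactor.
rewrite -sqrtrM; last by rewrite divr_ge0 // mulr_ge0 // ltW.
move: (N%:R : R) (d%:R : R) (k%:R : R) NR dR kR Nd dk Nk => n e j n0 e0 j0 ne ej nj.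
have -> : ((1 - e / n) * (e / n) * (j / e) * (e / n) * (1 - j / e))^-1 =
    n ^+ 2 * (n / (e * (n - e)) * (e / (j * (e - j)))).
  by field; rewrite !gt_eqF.
rewrite [in RHS]sqrtrM ?sqr_ge0 // sqrtr_sqr gtr0_norm //.
have -> : (1 - e / n) / (1 - e / n * (j / e)) = (n - e) / (n - j).
  by field; rewrite !gt_eqF.
by ring.
Qed.

Lemma defect_bounds d N k q : (1 <= k)%N -> (k < d)%N -> (d < N)%N ->
  0 <= q < 1 -> (N - d)%:R <= q * (d - k)%:R ->
  2 * expR (- (5 / 2)) * prefactor (d%:R / N%:R) (k%:R / d%:R)
  <= defect d N k * N%:R * expR (- (N%:R * G (d%:R / N%:R) (k%:R / d%:R)))
  <= 2 * prefactor (d%:R / N%:R) (k%:R / d%:R) / (1 - q).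
Proof.
move=> k1 kd dN q01 Nq; have kN := ltn_trans kd dN.
have mt : (d - k <= (N - k).-1)%N by lia.
have tm : ((N - k).-1 - (d - k) <= N - d)%N by lia.
have Nk0 : (0 < N - k)%N by rewrite subn_gt0.
have Nd0 : (0 < N - d)%N by rewrite subn_gt0.
have d0 : (0 < d < N)%N by rewrite dN andbT; exact: leq_ltn_trans kd.
have k0 : (0 < k < d)%N by rewrite kd andbT.
have NkNd : (N - k - (d - k) = N - d)%N by lia.
have /andP[q0 q1] := q01; have q1' : 0 < 1 - q by rewrite subr_gt0.
set A : R := \sum_(i < N - d) 'C((N - k).-1, d - k + i)%:R.
(* [th] is the ratio of the tail to its first term; the geometric estimate bounds it. *)
have [th /andP[th1 th2] AE] : exists2 th : R, 1 <= th <= (1 - q)^-1 &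
    A = th * 'C((N - k).-1, d - k)%:R.
  have C0 : 0 < 'C((N - k).-1, d - k)%:R :> R by rewrite ltr0n bin_gt0.
  exists (A / 'C((N - k).-1, d - k)%:R); last by rewrite divfK // gt_eqF.
  apply/andP; split.
    rewrite ler_pdivlMr // mul1r /A; case: (N - d)%N Nd0 => // n _.
    by rewrite big_ord_recl addn0 lerDl sumr_ge0.
  rewrite ler_pdivrMr // mulrC; apply: binomial_tail_le => //.
  apply: (@le_trans _ _ (N - d)%:R); first by rewrite -natrB // ler_nat.
  by apply: (le_trans Nq); rewrite ler_wpM2l // ler_nat.
have [c1 /andP[c1l c1u] C1E] := @bin_entropyE R N d d0.
have [c2 /andP[c2l c2u] C2E] := @bin_entropyE R d k k0.
have DE : defect d N k * N%:R * expR (- (N%:R * G (d%:R / N%:R) (k%:R / d%:R)))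
    = 2 * th * prefactor (d%:R / N%:R) (k%:R / d%:R) * expR (c1 + c2).
  (* Lowering the upper index from [N - k] to its predecessor costs the factor [(N - d) / (N - k)];
     the remaining product is [mul_bin_bin]. *)
  have binE : 'C(N, k)%:R * 'C((N - k).-1, d - k)%:R =
      'C(N, d)%:R * 'C(d, k)%:R * ((N - d)%:R / (N - k)%:R) :> R.
    have NkR : (N - k)%:R != 0 :> R by rewrite pnatr_eq0 -lt0n.
    apply: (mulIf NkR); rewrite -!mulrA mulVf // mulr1 -!natrM; congr (_%:R).
    by rewrite [('C((N - k).-1, _) * _)%N]mulnC mul_bin_down NkNd mulnCA mul_bin_bin
      1?ltnW // mulnC mulnA.
  rewrite defectE // -/A AE expR_mulG // -prefactorE // expRD.
  have e1 := expR_gt0 (N%:R * entropy (d%:R / N%:R : R)).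
  have e2 := expR_gt0 (d%:R * entropy (k%:R / d%:R : R)).
  have p2 : 2 ^+ (N - k) != 0 :> R by rewrite expf_neq0.
  transitivity (2 * th * N%:R * ('C(N, k)%:R * 'C((N - k).-1, d - k)%:R)
     / expR (N%:R * entropy (d%:R / N%:R)) / expR (d%:R * entropy (k%:R / d%:R))).
    move: (expR _) (expR _) e1 e2 (2 ^+ (N - k)) p2 => E1 E2 e1 e2 p p2.
    by field; rewrite p2 !gt_eqF.
  rewrite binE C1E C2E.
  have : (N - k)%:R != 0 :> R by rewrite pnatr_eq0 -lt0n.
  move: (expR (N%:R * _)) (expR (d%:R * _)) e1 e2 => E1 E2 e1 e2.
  move: ((N - k)%:R : R) ((N - d)%:R : R) (Num.sqrt _) (Num.sqrt _) (expR c1) (expR c2).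
  by move=> a b s1 s2 f1 f2 a0; field; rewrite a0 !gt_eqF.
have pf0 : 0 <= prefactor (d%:R / N%:R) (k%:R / d%:R) :> R.
  by rewrite -prefactorE // !mulr_ge0 ?sqrtr_ge0 // invr_ge0.
rewrite DE; move: (prefactor _ _) pf0 => pf pf0.
(* Each of the two Stirling errors lies between -5/4 and -1/2. *)
have e12 : expR (- (5 / 2)) <= expR (c1 + c2) :> R by rewrite ler_expR; lra.
have e12' : expR (c1 + c2) <= 1 :> R by rewrite -expR0 ler_expR; lra.
have e0 := expR_ge0 (c1 + c2).
apply/andP; split.
  have -> : 2 * expR (- (5 / 2)) * pf = 2 * pf * expR (- (5 / 2)) by ring.
  apply: ler_pM => //; rewrite ?expR_ge0 ?mulr_ge0 //.
  by rewrite ler_wpM2r // ler_peMr.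
have -> : 2 * pf / (1 - q) = 2 * (1 - q)^-1 * pf * 1 by ring.
apply: ler_pM => //; first by rewrite !mulr_ge0 // (le_trans _ th1).
by rewrite ler_wpM2r // ler_wpM2l.
Qed.

End Defect.

(** * The exponent [G] *)

Section EntropyAndG.
Context (R : realType).
Implicit Types (a b p t x delta : R).

(** This is [ln y <= y - 1] at [y = p / a], multiplied by [a], with its case of equality; [a = 0] is
    separate. *)
Lemma mulr_ln_le a p : 0 <= a -> 0 < p -> a * ln p - a * ln a <= p - a ?= iff (a == p).
Proof.
rewrite le_eqVlt eq_sym => /orP[/eqP-> p0|a0 p0].
  by rewrite !mul0r !subr0; split; [exact: ltW|rewrite eq_sym].
have -> : a * ln p - a * ln a = a * ln (p / a) by rewrite ln_div ?posrE // mulrBr.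
have pa : 0 < p / a by rewrite divr_gt0.
have [->|ap] := eqVneq a p.
  by rewrite divff ?gt_eqF // ln1 mulr0 subrr; split; rewrite ?eqxx.
have lt : a * ln (p / a) < p - a.
  have -> : p - a = a * (p / a - 1) by field; rewrite gt_eqF.
  rewrite ltr_pM2l // ltrBrDl -{2}(lnK (x := p / a)) ?posrE //.
  apply: expR_gt1Dx; rewrite ln_eq0 //; apply: contra ap => /eqP h.
  by have := divfK (lt0r_neq0 a0) p; rewrite h mul1r => ->.
by split; [exact: ltW|exact: lt_eqF].
Qed.

(** Gibbs' inequality, the sum of two instances of [mulr_ln_le]. *)
Lemma entropy_le_cross a p : 0 <= a <= 1 -> 0 < p < 1 ->
  entropy a <= - a * ln p - (1 - a) * ln (1 - p) ?= iff (a == p).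
Proof.
move=> /andP[a0 a1] /andP[p0 p1].
have [h1 e1] := mulr_ln_le a0 p0.
have a1' : 0 <= 1 - a by rewrite subr_ge0.
have p1' : 0 < 1 - p by rewrite subr_gt0.
have [h2 e2] := mulr_ln_le a1' p1'.
split; first by rewrite /entropy; lra.
apply/eqP/eqP => [E|->//]; apply/eqP; rewrite -e1; apply/eqP.
by move: E; rewrite /entropy; lra.
Qed.

(** The cross entropy with respect to [p] is affine in the first argument, lies above the entropy
    and touches it at [p]. *)
Lemma entropy_concave a b t : 0 <= a <= 1 -> 0 <= b <= 1 -> 0 <= t <= 1 ->
  0 < (1 - t) * a + t * b < 1 ->
  (1 - t) * entropy a + t * entropy b <= entropy ((1 - t) * a + t * b).
Proof.
set p := (1 - t) * a + t * b => a01 b01 /andP[t0 t1] p01.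
have [ha _] := entropy_le_cross a01 p01; have [hb _] := entropy_le_cross b01 p01.
have t1' : 0 <= 1 - t by rewrite subr_ge0.
apply: (le_trans (lerD (ler_wpM2l t1' ha) (ler_wpM2l t0 hb))).
by rewrite /entropy le_eqVlt; apply/orP; left; apply/eqP; rewrite /p; ring.
Qed.

Lemma G_concave delta a b t : 0 <= delta ->
  0 <= a <= 1 -> 0 <= b <= 1 -> 0 <= t <= 1 ->
  0 < (1 - t) * a + t * b < 1 ->
  (1 - t) * G delta a + t * G delta b <= G delta ((1 - t) * a + t * b).
Proof.
move=> d0 a01 b01 t01 p01; rewrite /G.
have := ler_wpM2l d0 (entropy_concave a01 b01 t01 p01).
move: (entropy a) (entropy b) (entropy (_ + _)) (ln 2) (entropy delta) => ea eb ep l ed.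
by move=> h; lra.
Qed.

Lemma entropy0 : entropy (0 : R) = 0.
Proof. by rewrite /entropy subr0 ln1 oppr0 !mul0r mulr0 subrr. Qed.

Lemma entropy1 : entropy (1 : R) = 0.
Proof. by rewrite /entropy ln1 subrr mulr0 mul0r subrr. Qed.

(** Strict Gibbs' inequality at 1/2 gives [entropy delta < ln 2]. *)
Lemma G0_lt0 delta : 2^-1 < delta < 1 -> G delta 0 < 0.
Proof.
move=> /andP[d1 d2]; have d01 : 0 <= delta <= 1 by apply/andP; split; lra.
have h01 : 0 < (2^-1 : R) < 1 by apply/andP; split; lra.
have := entropy_le_cross d01 h01.
have -> : 1 - 2^-1 = 2^-1 :> R by field.
rewrite lnV ?posrE // => h.
have : entropy delta < ln 2.
  have := lt_leif h; rewrite (gt_eqF d1) /= => h'.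
  by apply: (lt_le_trans h'); rewrite le_eqVlt; apply/orP; left; apply/eqP; ring.
by rewrite /G entropy0; lra.
Qed.

Lemma G1_gt0 delta : 2^-1 < delta < 1 -> 0 < G delta 1.
Proof.
move=> /andP[d1 d2]; have d0 : 0 < delta by lra.
have l1 : ln delta < 0 by rewrite ln_lt0 // d0.
have l2 : ln ((1 - delta) * 2) < 0 by rewrite ln_lt0 //; apply/andP; split; lra.
have d1' : 0 < 1 - delta by lra.
rewrite lnM ?posrE // in l2.
rewrite /G entropy1 /entropy.
have h1 : 0 < delta * - ln delta by rewrite mulr_gt0 // oppr_gt0.
have h2 : 0 < (1 - delta) * - (ln (1 - delta) + ln 2) by rewrite mulr_gt0 // oppr_gt0.
by lra.
Qed.

Lemma cvg_entropy (T : Type) (F : set_system T) {FF : Filter F} (f : T -> R) p :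
  0 < p < 1 -> f @ F --> p -> entropy (f x) @[x --> F] --> entropy p.
Proof.
move=> /andP[p0 p1] fp.
have l1 : ln (f x) @[x --> F] --> ln p by apply: continuous_cvg => //;
  exact: continuous_ln.
have f1 : 1 - f x @[x --> F] --> 1 - p by apply: cvgB => //; exact: cvg_cst.
have l2 : ln (1 - f x) @[x --> F] --> ln (1 - p).
  by apply: continuous_cvg => //; apply: continuous_ln; rewrite subr_gt0.
rewrite /entropy; apply: cvgB; apply: cvgM => //; exact: cvgN.
Qed.

Lemma cvg_G (T : Type) (F : set_system T) {FF : Filter F} (f g : T -> R) delta x :
  0 < delta < 1 -> 0 < x < 1 -> f @ F --> delta -> g @ F --> x ->
  G (f y) (g y) @[y --> F] --> G delta x.
Proof.
move=> d01 x01 fd gx; rewrite /G; apply: cvgB.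
  apply: cvgD; first exact: cvg_entropy.
  by apply: cvgM => //; exact: cvg_entropy.
apply: cvgM; last exact: cvg_cst.
by apply: cvgB; [exact: cvg_cst|exact: cvgM].
Qed.

(** This carries the sign at 0 to an interior point, where [cvg_G] provides continuity. *)
Lemma G_small_lt0 delta : 2^-1 < delta < 1 -> exists2 a, 0 < a < 1 & G delta a < 0.
Proof.
move=> d01; have g0 := G0_lt0 d01; move: d01 => /andP[d1 d2].
(* At [e * e] the entropy is at most [3 * e], because [- e * ln e <= 1]. Hence [G] grows by at most
   [3 * e + e * e], which is less than [- G delta 0]. *)
pose e := Num.min 2^-1 (- G delta 0 / 8).
have e0 : 0 < e by rewrite lt_min; apply/andP; split; lra.
have e1 : e <= 2^-1 by rewrite ge_min lexx.
have e2 : e <= - G delta 0 / 8 by rewrite ge_min lexx orbT.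
have ee : e * e <= e / 2 by rewrite ler_wpM2l // ltW.
exists (e * e); first by apply/andP; split; [exact: mulr_gt0|lra].
have [h1 _] := mulr_ln_le (ltW e0) (ltr01 : 0 < 1 :> R).
have a1' : 0 <= 1 - e * e by lra.
have [h2 _] := mulr_ln_le a1' (ltr01 : 0 < 1 :> R).
rewrite ln1 mulr0 sub0r in h1; rewrite ln1 mulr0 sub0r in h2.
have h3 : - (e * e) * ln (e * e) <= 2 * e.
  rewrite lnM ?posrE //.
  have -> : - (e * e) * (ln e + ln e) = 2 * e * (- (e * ln e)) by ring.
  by rewrite ler_piMr ?mulr_ge0 ?ltW //; lra.
have H : entropy (e * e) <= 3 * e by rewrite /entropy; lra.
have H0 : 0 <= 3 * e - entropy (e * e) by lra.
have l2 : ln 2 <= 1 :> R by have := @le_ln1Dx R 1; rewrite -natr1; apply; lra.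
have l0 : 0 <= ln 2 :> R by rewrite ln_ge0 // ler1n.
have E : G delta (e * e) = G delta 0 + delta * entropy (e * e) + delta * (e * e * ln 2).
  by rewrite /G entropy0; ring.
have b1 : delta * entropy (e * e) <= 1 * (3 * e).
  apply: (@le_trans _ _ (delta * (3 * e))); first by rewrite ler_wpM2l //; lra.
  by rewrite ler_wpM2r //; lra.
have b2 : delta * (e * e * ln 2) <= 1 * (e * e * 1).
  apply: (@le_trans _ _ (delta * (e * e * 1))).
    by rewrite ler_wpM2l ?ler_wpM2l ?mulr_ge0 //; lra.
  by rewrite ler_wpM2r ?mulr_ge0 //; lra.
by rewrite E; lra.
Qed.

Lemma G_zero_exists delta : 2^-1 < delta < 1 ->
  exists x, 0 <= x <= 1 /\ G delta x = 0.
Proof.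
move=> d01; have g0 := G0_lt0 d01; have g1 := G1_gt0 d01.
have [a /andP[a0 a1] Ga] := G_small_lt0 d01.
move: d01 => /andP[d1 d2].
pose s := G delta 1 - G delta 0.
have s0 : 0 < s by rewrite /s; lra.
(* At [t] the chord of [G delta] over the unit interval has height [G delta 1 / 2], and concavity
   puts [G] above it. *)
pose t := (G delta 1 / 2 - G delta 0) / s.
have t0 : 0 < t by rewrite divr_gt0 //; lra.
have t1 : t < 1 by rewrite ltr_pdivrMr // mul1r /s; lra.
have Gt : 0 < G delta t.
  have := @G_concave delta 0 1 t; rewrite mulr0 add0r mulr1 => h.
  have h' : (1 - t) * G delta 0 + t * G delta 1 <= G delta t.
    by apply: h; rewrite ?lexx ?ler01 ?t0 ?t1 //; [lra|apply/andP; split; lra].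
  apply: lt_le_trans h'.
  have -> : (1 - t) * G delta 0 + t * G delta 1 = G delta 0 + t * s by rewrite /s; ring.
  by rewrite /t divfK ?gt_eqF //; lra.
have cG x : 0 < x < 1 -> {for x, continuous (G delta)}.
  move=> x01; apply: (@cvg_G _ _ _ (cst delta) id) => //; last exact: cvg_cst.
  by apply/andP; split; lra.
have [l|l] := leP a t.
  have [||c] := @IVT R (G delta) a t 0 l.
  - apply: continuous_in_subspaceT => x; rewrite inE /= in_itv /= => /andP[x1 x2].
    by apply: cG; apply/andP; split; lra.
  - by rewrite ge_min le_max (ltW Ga) (ltW Gt) orbT.
  - rewrite in_itv /= => /andP[c1 c2] Gc; exists c; split => //.
    by apply/andP; split; lra.
have [||c] := @IVT R (G delta) t a 0 (ltW l).
- apply: continuous_in_subspaceT => x; rewrite inE /= in_itv /= => /andP[x1 x2].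
  by apply: cG; apply/andP; split; lra.
- by rewrite ge_min le_max (ltW Ga) (ltW Gt) orbT.
- rewrite in_itv /= => /andP[c1 c2] Gc; exists c; split => //.
  by apply/andP; split; lra.
Qed.

Lemma rho_SP delta : 2^-1 < delta < 1 ->
  0 <= rho_S delta <= 1 /\ G delta (rho_S delta) = 0.
Proof. by move=> d01;
  exact: (@xgetPex R 0 [set x | 0 <= x <= 1 /\ G delta x = 0] (G_zero_exists d01)). Qed.

Lemma G_lt0 delta x : 2^-1 < delta < 1 -> 0 <= x -> x < rho_S delta -> G delta x < 0.
Proof.
move=> d01 x0; have [/andP[z0 z1] Gz] := rho_SP d01; have g1 := G1_gt0 d01.
move: z0 z1 Gz; set z := rho_S delta => z0 z1 Gz xz.
have {}z1 : z < 1.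
  by rewrite lt_neqAle z1 andbT; apply/eqP => E; rewrite E in Gz; lra.
rewrite ltNge; apply/negP => Gx.
move: d01 => /andP[d1 d2].
(* [z] lies between [x] and 1. If [G] were nonnegative at [x], then concavity and [G delta 1 > 0]
   would make it positive at [z]. *)
pose t := (z - x) / (1 - x).
have t0 : 0 < t by rewrite divr_gt0; lra.
have t1 : t < 1 by rewrite ltr_pdivrMr; lra.
have zE : (1 - t) * x + t * 1 = z by rewrite /t; field; rewrite gt_eqF //; lra.
have h : (1 - t) * G delta x + t * G delta 1 <= G delta z.
  by rewrite -[in leRHS]zE; apply: G_concave; rewrite ?zE ?lexx ?ler01 //;
    try (apply/andP; split); lra.
have h1 : 0 <= (1 - t) * G delta x by rewrite mulr_ge0 //; lra.
have h2 : 0 < t * G delta 1 by rewrite mulr_gt0.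
by lra.
Qed.

Lemma G_gt0 delta x : 2^-1 < delta < 1 -> rho_S delta < x -> x < 1 -> 0 < G delta x.
Proof.
move=> d01; have [/andP[z0 z1] Gz] := rho_SP d01; have g1 := G1_gt0 d01.
move: z0 z1 Gz; set z := rho_S delta => z0 z1 Gz zx x1.
move: d01 => /andP[d1 d2].
pose t := (x - z) / (1 - z).
have t0 : 0 < t by rewrite divr_gt0; lra.
have t1 : t < 1 by rewrite ltr_pdivrMr; lra.
have xE : (1 - t) * z + t * 1 = x by rewrite /t; field; rewrite gt_eqF //; lra.
have h : (1 - t) * G delta z + t * G delta 1 <= G delta x.
  by rewrite -[in leRHS]xE; apply: G_concave; rewrite ?xE ?lexx ?ler01 //;
    try (apply/andP; split); lra.
rewrite Gz mulr0 add0r in h.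
by apply: lt_le_trans h; rewrite mulr_gt0.
Qed.

End EntropyAndG.

(** * Asymptotics of the defect *)

Section Asymptotics.
Context (R : realType) (delta rho : R).
Hypotheses (hdelta : 2^-1 < delta < 1) (hrho : 0 < rho < 2 - delta^-1).

Lemma rho_lt1 : rho < 1.
Proof.
have /andP[r0 r1] := hrho; have /andP[d0 d1] := hdelta.
have : 1 < delta^-1 by rewrite invf_gt1 //; lra.
by lra.
Qed.

Section Admissible.
Context (k N : nat -> nat).
Hypothesis kN : admissible delta rho k N.

Let al d : R := d%:R / (N d)%:R.
Let be d : R := (k d)%:R / d%:R.

Let al_cvg : al d @[d --> \oo] --> delta. Proof. by case: kN. Qed.
Let be_cvg : be d @[d --> \oo] --> rho. Proof. by case: kN. Qed.

Let kdN d : (2 <= d)%N -> [/\ (1 <= k d)%N, (k d < d)%N & (d < N d)%N].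
Proof. by case: kN => + _ _ => /(_ d) h /h/and3P. Qed.

Let dl0 : 0 < delta. Proof. by have /andP[d0 d1] := hdelta; lra. Qed.

(** This is the factor [g] of the theorem. *)
Definition scaled_defect d : R :=
  defect R d (N d) (k d) * (N d)%:R * expR (- ((N d)%:R * G (al d) (be d))).

Lemma scaled_defect_gt0 d : (2 <= d)%N -> 0 < scaled_defect d.
Proof.
move=> /kdN[k1 kd dN]; apply: mulr_gt0 (expR_gt0 _).
apply: mulr_gt0; first exact: defect_gt0.
by rewrite ltr0n (leq_ltn_trans _ dN).
Qed.

Lemma defect_scaledE d : (2 <= d)%N ->
  defect R d (N d) (k d) = (N d)%:R^-1 * expR ((N d)%:R * G (al d) (be d)) *
    scaled_defect d.
Proof.
move=> /kdN[k1 kd dN]; rewrite /scaled_defect expRN; field.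
by rewrite gt_eqF ?expR_gt0 //= pnatr_eq0 -lt0n (leq_ltn_trans _ dN).
Qed.

Lemma scaled_defect_eventually : exists a b : R,
  [/\ 0 < a, a <= b & \forall d \near \oo, a <= scaled_defect d <= b].
Proof.
have /andP[d0 d1] := hdelta; have /andP[r0 r1] := hrho; have r2 := rho_lt1.
pose h := prefactor delta rho.
have h0 : 0 < h.
  rewrite /h /prefactor mulr_gt0 //.
    rewrite divr_gt0 //; first by lra.
    by rewrite subr_gt0 mulr_ilt1 //; lra.
  by rewrite sqrtr_gt0 invr_gt0 !mulr_gt0 //; lra.
have hcvg : prefactor (al d) (be d) @[d --> \oo] --> h.
  have a1 : 1 - al d @[d --> \oo] --> 1 - delta by apply: cvgB => //; exact: cvg_cst.
  have b1 : 1 - be d @[d --> \oo] --> 1 - rho by apply: cvgB => //; exact: cvg_cst.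
  rewrite /h /prefactor; apply: cvgM.
    apply: cvgM => //; apply: cvgV.
      by rewrite gt_eqF // subr_gt0 mulr_ilt1 //; lra.
    by apply: cvgB; [exact: cvg_cst|exact: cvgM].
  apply: continuous_cvg; first exact: sqrt_continuous.
  apply: cvgV; first by rewrite gt_eqF // !mulr_gt0 //; lra.
  by do 4! [apply: cvgM => //].
(* [q0] is the limit of [(N - d) / (d - k)], and it is below 1 exactly because [rho < 2 - delta^-1].
   The midpoint [q] of [q0] and 1 bounds this ratio eventually. *)
pose q0 := (delta^-1 - 1) / (1 - rho).
have q00 : 0 <= q0.
  rewrite divr_ge0 //; last by lra.
  by rewrite subr_ge0 invf_ge1 //; lra.
have q01 : q0 < 1 by rewrite ltr_pdivrMr; lra.
pose q := (1 + q0) / 2.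
have q1 : 0 <= q < 1 by apply/andP; split; rewrite /q; lra.
have qcvg : q * (1 - be d) - ((al d)^-1 - 1) @[d --> \oo] --> q * (1 - rho) -
  (delta^-1 - 1).
  apply: cvgB; first by apply: cvgM; [exact: cvg_cst|apply: cvgB => //; exact: cvg_cst].
  by apply: cvgB; [apply: cvgV => //; rewrite gt_eqF|exact: cvg_cst].
have qpos : 0 < q * (1 - rho) - (delta^-1 - 1).
  have -> : delta^-1 - 1 = q0 * (1 - rho) by rewrite /q0 divfK // gt_eqF //; lra.
  by rewrite -mulrBl mulr_gt0 //; [rewrite /q; lra|lra].
exists (2 * expR (- (5 / 2)) * (h / 2)), (2 * (2 * h) / (1 - q)).
have /andP[q1a q1b] := q1.
split.
- apply: mulr_gt0; last exact: divr_gt0.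
  by apply: mulr_gt0 => //; exact: expR_gt0.
- have e1 : expR (- (5 / 2)) <= 1 :> R by rewrite -[leRHS]expR0 ler_expR; lra.
  apply: (@le_trans _ _ (2 * (2 * h))).
    apply: (@le_trans _ _ (2 * 1 * (h / 2))); last by lra.
    by rewrite ler_wpM2r ?ler_wpM2l //; lra.
  have hh0 : 0 <= 2 * (2 * h) by lra.
  have q1c : 0 < 1 - q by lra.
  by rewrite ler_pdivlMr // ler_piMr //; lra.
near=> d.
have d2 : (2 <= d)%N by near: d; exact: nbhs_infty_ge.
have [k1 kd dN] := kdN d2.
have dR : 0 < d%:R :> R by rewrite ltr0n (leq_ltn_trans _ kd).
have NR : 0 < (N d)%:R :> R by rewrite ltr0n (leq_ltn_trans _ dN).
have hq : (N d - d)%:R <= q * (d - k d)%:R.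
  rewrite !natrB ?(ltnW kd) ?(ltnW dN) //.
  have : 0 <= q * (1 - be d) - ((al d)^-1 - 1).
    by near: d; exact: (cvgr_ge _ qcvg).
  rewrite /al /be invf_div => hh.
  rewrite -subr_ge0; have -> : q * (d%:R - (k d)%:R) - ((N d)%:R - d%:R) =
      d%:R * (q * (1 - (k d)%:R / d%:R) - ((N d)%:R / d%:R - 1)) :> R.
    by field; rewrite gt_eqF.
  by rewrite mulr_ge0 // ltW.
have /andP[lo up] := defect_bounds k1 kd dN q1 hq.
have h1 : h / 2 <= prefactor (al d) (be d).
  by near: d; apply: (cvgr_ge _ hcvg); lra.
have h2 : prefactor (al d) (be d) <= 2 * h.
  by near: d; apply: (cvgr_le _ hcvg); lra.
apply/andP; split.
  by apply: le_trans lo; rewrite ler_wpM2l // mulr_ge0 ?expR_ge0.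
apply: (le_trans up); rewrite ler_wpM2r ?invr_ge0 ?ler_wpM2l //; lra.
Unshelve. all: by end_near.
Qed.

(** The finitely many values before the eventual bounds hold are positive; descending on the
    threshold, each is absorbed by a minimum and a maximum. *)
Lemma scaled_defect_bounded : exists a b : R,
  [/\ 0 < a, a <= b & forall d, (2 <= d)%N -> a <= scaled_defect d <= b].
Proof.
have [a [b [a0 ab [M _ Mab]]]] := scaled_defect_eventually.
have {}Mab d : (M <= d)%N -> a <= scaled_defect d <= b by move=> Md; exact: Mab.
elim: M a b a0 ab Mab => [|M IH] a b a0 ab Mab.
  by exists a, b; split => // d _; exact: Mab.
have [M2|M2] := ltnP M 2.
  by exists a, b; split => // d d2; apply: Mab; apply: leq_trans d2.
apply: (IH (Num.min a (scaled_defect M)) (Num.max b (scaled_defect M))).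
- by rewrite lt_min a0 scaled_defect_gt0.
- by rewrite ge_min le_max ab.
move=> d; rewrite leq_eqVlt => /orP[/eqP<-|/Mab/andP[h1 h2]].
  by rewrite ge_min le_max !lexx !orbT.
by rewrite ge_min le_max h1 h2.
Qed.

Let G_cvg : G (al d) (be d) @[d --> \oo] --> G delta rho.
Proof.
have /andP[d0 d1] := hdelta; have /andP[r0 r1] := hrho; have r2 := rho_lt1.
by apply: cvg_G => //; apply/andP; split; lra.
Qed.

Let Nle d : (2 <= d)%N -> (N d)%:R^-1 <= d%:R^-1 :> R.
Proof.
move=> /[dup] d2 /kdN[_ kd dN].
by rewrite lef_pV2 ?posrE ?ltr0n ?ler_nat ?(ltnW dN) // (leq_ltn_trans _ kd,
  leq_ltn_trans _ dN).
Qed.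

(** Eventually the exponent is nonpositive, and the factor [1 / N <= 1 / d] tends to 0. *)
Lemma defect_small e : G delta rho < 0 -> 0 < e ->
  \forall d \near \oo, defect R d (N d) (k d) <= e.
Proof.
move=> G0 e0; have [a [b [a0 ab sab]]] := scaled_defect_bounded.
have b0 : 0 < b by exact: lt_le_trans ab.
near=> d.
have d2 : (2 <= d)%N by near: d; exact: nbhs_infty_ge.
have [k1 kd dN] := kdN d2; have /andP[_ sb] := sab d d2.
have dR : 0 < d%:R :> R by rewrite ltr0n (leq_ltn_trans _ kd).
have g0 : G (al d) (be d) <= 0 by near: d; exact: (cvgr_le _ G_cvg).
have db : b / e <= d%:R by near: d; exact: nbhs_infty_ger.
rewrite defect_scaledE //; apply: (@le_trans _ _ (d%:R^-1 * 1 * b)).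
  have s0 := ltW (scaled_defect_gt0 d2).
  have p0 : 0 <= (N d)%:R^-1 * expR ((N d)%:R * G (al d) (be d)).
    by apply: mulr_ge0; rewrite ?expR_ge0 ?invr_ge0 ?ler0n.
  apply: ler_pM => //.
  apply: ler_pM; rewrite ?expR_ge0 ?invr_ge0 //; first exact: Nle.
  by rewrite -[leRHS]expR0 ler_expR mulr_ge0_le0.
by rewrite mulr1 mulrC ler_pdivrMr // mulrC -ler_pdivrMr.
Unshelve. all: by end_near.
Qed.

Lemma defect_large A : 0 < G delta rho ->
  \forall d \near \oo, A <= defect R d (N d) (k d).
Proof.
move=> G0; have [a [b [a0 ab sab]]] := scaled_defect_bounded.
have [c c0 cG] : exists2 c, 0 < c & c < G delta rho by exists (G delta rho / 2); lra.
(* Quadratic growth, from the square of [1 + x / 2 <= expR (x / 2)], still diverges after division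
   by [N]. *)
have lower x : 0 <= x -> x * x / 4 <= expR x :> R.
  move=> x0; have -> : x = x / 2 + x / 2 by field.
  rewrite expRD; have := expR_ge1Dx (x / 2).
  by move=> h; nra.
near=> d.
have d2 : (2 <= d)%N by near: d; exact: nbhs_infty_ge.
have [k1 kd dN] := kdN d2; have /andP[sa _] := sab d d2.
have NR : 0 < (N d)%:R :> R by rewrite ltr0n (leq_ltn_trans _ dN).
have g0 : c <= G (al d) (be d) by near: d; exact: (cvgr_ge _ G_cvg).
have dA : A / (c * c / 4 * a) <= d%:R by near: d; exact: nbhs_infty_ger.
have dNR : d%:R <= (N d)%:R :> R by rewrite ler_nat ltnW.
have K0 : 0 < c * c / 4 * a by rewrite !mulr_gt0 // invr_gt0.
rewrite defect_scaledE //.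
apply: (@le_trans _ _ ((N d)%:R * (c * c / 4 * a))).
  by rewrite -ler_pdivrMr // (le_trans dA).
have -> : (N d)%:R * (c * c / 4 * a) = (N d)%:R^-1 * (((N d)%:R * c) * ((N d)%:R * c)
  / 4) * a.
  by field; rewrite gt_eqF.
apply: ler_pM => //; [|exact: ltW|].
  by rewrite mulr_ge0 ?divr_ge0 ?mulr_ge0 ?invr_ge0 ?(ltW c0).
rewrite ler_wpM2l ?invr_ge0 ?(ltW NR) //.
apply: (le_trans (lower _ _)); first by rewrite mulr_ge0 ?(ltW c0) ?(ltW NR).
by rewrite ler_expR ler_wpM2l ?(ltW NR).
Unshelve. all: by end_near.
Qed.

End Admissible.
End Asymptotics.

(** * Oscillation at the threshold *)

Section Diagonal.
Context (R : realType).

Lemma diagonal_extraction (Q : nat -> nat -> Prop) :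
  (forall j, \forall d \near \oo, Q j d) ->
  exists2 J : nat -> nat, forall i, \forall d \near \oo, (i <= J d)%N
                        & \forall d \near \oo, Q (J d) d.
Proof.
move=> Qev; have /choice[M MQ] : forall j, exists M, forall d, (M <= d)%N -> Q j d.
  by move=> j; have [M _ MQ] := Qev j; exists M => d; exact: MQ.
(* [J d] is the largest index up to [d] whose threshold has been passed. The empty maximum defaults
   to 0, but from [M 0] on it is attained. *)
exists (fun d => \max_(j < d.+1 | (M j <= d)%N) j) => [i|].
  near=> d.
  have id : (i < d.+1)%N by rewrite ltnS; near: d; exact: nbhs_infty_ge.
  have Mi : (M i <= d)%N by near: d; exact: nbhs_infty_ge.
  exact: (@leq_bigmax_cond _ [pred j : 'I_d.+1 | (M j <= d)%N]
    (fun j => j : nat) (Ordinal id)).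
near=> d.
have M0 : (M 0%N <= d)%N by near: d; exact: nbhs_infty_ge.
have [|j Mj ->] := @eq_bigmax_cond _ [pred j : 'I_d.+1 | (M j <= d)%N] (fun j => j : nat).
  by apply/card_gt0P; exists ord0.
exact: MQ.
Unshelve. all: by end_near.
Qed.

(* The value 1 keeps [1 <= dim_seq r d < d] when [d] is small. *)
Definition dim_seq (r : R) (d : nat) : nat :=
  let n := (Num.truncn (r * d%:R)).+1 in if (n < d)%N then n else 1%N.

Definition size_seq (delta : R) (d : nat) : nat := (Num.truncn (d%:R / delta)).+1.

Lemma cvg_truncnS (r : R) : 0 <= r ->
  (Num.truncn (r * d%:R)).+1%:R / d%:R @[d --> \oo] --> r.
Proof.
move=> r0; apply/cvgrPdist_le => e e0; near=> d.
have d0 : 0 < d%:R :> R by rewrite ltr0n; near: d; exact: nbhs_infty_gt.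
have de : e^-1 <= d%:R by near: d; exact: nbhs_infty_ger.
have rd : 0 <= r * d%:R by rewrite mulr_ge0 // ltW.
have /andP[lo up] := truncn_itv rd.
have lo' : r <= (Num.truncn (r * d%:R)).+1%:R / d%:R by rewrite ler_pdivlMr // ltW.
have up' : (Num.truncn (r * d%:R)).+1%:R / d%:R <= r + d%:R^-1.
  rewrite ler_pdivrMr // mulrDl mulVf ?gt_eqF // -natr1 lerD2r //.
have dV : d%:R^-1 <= e by rewrite -[e]invrK lef_pV2 ?posrE ?invr_gt0.
by rewrite distrC ger0_norm; lra.
Unshelve. all: by end_near.
Qed.

Lemma dim_seq_cvg (r : R) : 0 <= r < 1 -> (dim_seq r d)%:R / d%:R @[d --> \oo] --> r.
Proof.
move=> /andP[r0 r1].
have h := cvg_truncnS r0.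
apply: cvg_trans h; apply: near_eq_cvg; near=> d; rewrite /dim_seq.
have d0 : 0 < d%:R :> R by rewrite ltr0n; near: d; exact: nbhs_infty_gt.
have : (Num.truncn (r * d%:R)).+1%:R / d%:R < 1 :> R by near: d;
  exact: (cvgr_lt _ (cvg_truncnS r0)).
by rewrite ltr_pdivrMr // mul1r ltr_nat => ->.
Unshelve. all: by end_near.
Qed.

Lemma dim_seqP (r : R) d : (2 <= d)%N -> (1 <= dim_seq r d < d)%N.
Proof. by move=> d2; rewrite /dim_seq; case: ifP => [->|_]. Qed.

Lemma size_seqP (delta : R) d : 0 < delta < 1 -> (1 <= d)%N -> (d < size_seq delta d)%N.
Proof.
move=> /andP[d0 d1] d1'; have dR : 0 < d%:R :> R by rewrite ltr0n.
rewrite -(ltr_nat R); have /andP[_] := truncn_itv (ltW (divr_gt0 dR d0)).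
apply: lt_trans.
by rewrite ltr_pdivlMr // gtr_pMr.
Qed.

Lemma size_seq_cvg (delta : R) : 0 < delta ->
  d%:R / (size_seq delta d)%:R @[d --> \oo] --> delta.
Proof.
move=> d0; have iv : 0 <= delta^-1 by rewrite invr_ge0 ltW.
have -> : (fun d => d%:R / (size_seq delta d)%:R : R) =
          (fun d => ((Num.truncn (delta^-1 * d%:R)).+1%:R / d%:R)^-1).
  by apply/funext => d; rewrite invf_div /size_seq [delta^-1 * _]mulrC.
rewrite -[X in _ --> X]invrK; apply: cvgV; first by rewrite gt_eqF // invr_gt0.
exact: cvg_truncnS.
Qed.

Lemma admissible_seqs (delta r : R) : 0 < delta < 1 -> 0 <= r < 1 ->
  admissible delta r (dim_seq r) (size_seq delta).
Proof.
move=> d01 r01; split; [|by apply: size_seq_cvg; case/andP: d01|exact: dim_seq_cvg].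
move=> d d2; have /andP[-> ->] := dim_seqP r d2.
by rewrite /= size_seqP // ltnW.
Qed.

(** The infimum over every late tail is exactly 0, so the limit is that of an eventually constant
    sequence. *)
Lemma limn_einf_eq0 (u : nat -> \bar R) :
  (\forall n \near \oo, 0 <= u n)%E ->
  (forall e : R, 0 < e -> forall n, exists2 m, (n <= m)%N & (u m <= e%:E)%E) ->
  limn_einf u = 0%E.
Proof.
move=> [M _ u0] small; rewrite limn_einf_lim; apply/cvg_lim => //.
have h : (fun _ : nat => 0%E : \bar R) @ \oo --> 0%E by exact: cvg_cst.
apply: cvg_trans h; apply: near_eq_cvg; near=> n.
have Mn : (M <= n)%N by near: n; exact: nbhs_infty_ge.
apply/esym/eqP; rewrite /einfs eq_le; apply/andP; split.
  apply/lee_addgt0Pr => e e0; rewrite add0e.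
  have [m nm um] := small e e0 n; apply: le_trans um.
  by apply: ereal_inf_lbound; exists m.
apply/ereal_infP => _ [m /= nm <-]; apply: u0 => /=.
exact: leq_trans nm.
Unshelve. all: by end_near.
Qed.

Lemma limn_esup_eqy (u : nat -> \bar R) :
  (forall A : R, forall n, exists2 m, (n <= m)%N & (A%:E <= u m)%E) ->
  limn_esup u = +oo%E.
Proof.
move=> large; rewrite limn_esup_lim; apply/cvg_lim => //.
have h : (fun _ : nat => +oo%E : \bar R) @ \oo --> +oo%E by exact: cvg_cst.
apply: cvg_trans h; apply: near_eq_cvg; near=> n; apply: esym.
apply: eq_infty => A; have [m nm um] := large A n; apply: (le_trans um).
by apply: ereal_sup_ubound; exists m.
Unshelve. all: by end_near.
Qed.

End Diagonal.

Lemma face_defectE (R : realType) d N disp (T : measurableType disp)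
    (P : probability T R) (phi : probability (borel_rV R d) R)
    (X : 'I_N -> {RV P >-> borel_rV R d}) k :
  even_measure phi -> null_on_hyperplanes phi -> iid_sample phi X ->
  (k < d)%N -> face_defect X k = (defect R d N k)%:E.
Proof.
move=> ev hyp iid kd; rewrite /face_defect (expected_facesE iid hyp ev kd).
by rewrite -EFinB /defect mulrBr mulr1.
Qed.

(** Even [d] follow parameters [lo j] below the threshold, where the defect vanishes; odd [d] follow
    [up j] above it, where it diverges. Diagonal extraction lets [j] grow so slowly that both
    effects persist. *)
Lemma defect_oscillates (R : realType) (delta rho : R) :
  2^-1 < delta < 1 -> 0 < rho < 2 - delta^-1 -> rho = rho_S delta ->
  exists k N : nat -> nat, admissible delta rho k N /\
    forall (e A : R), 0 < e -> \forall d \near \oo,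
      if odd d then A <= defect R d (N d) (k d) else defect R d (N d) (k d) <= e.
Proof.
move=> hd hr rS; have r1 := rho_lt1 hd hr.
have /andP[d0 d1] := hd; have /andP[r0 r2] := hr.
have d01 : 0 < delta < 1 by apply/andP; split; lra.
(* [s] is the room above [rho], so that every [up j] stays in the range of the asymptotic
   estimates. *)
pose s := 2 - delta^-1 - rho; have s0 : 0 < s by rewrite /s; lra.
have s1 : s <= 1 - rho.
  by have : 1 < delta^-1; [rewrite invf_gt1 //; lra|rewrite /s; lra].
pose c (j : nat) : R := j.+2%:R^-1.
have c0 j : 0 < c j by rewrite invr_gt0.
have c1 j : c j < 1 by rewrite invf_lt1 // ltr1n.
pose lo j := rho - rho * c j; pose up j := rho + s * c j.
have lo_itv j : 0 < lo j < rho.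
  have := c0 j; have := c1 j; rewrite /lo; move: (c j) => cj h1 h2.
  have := mulr_gt0 r0 h2; have : rho * cj < rho * 1 by rewrite ltr_pM2l.
  by move=> *; apply/andP; split; lra.
have up_itv j : rho < up j < 2 - delta^-1.
  have := c0 j; have := c1 j; rewrite /up; move: (c j) => cj h1 h2.
  have := mulr_gt0 s0 h2; have : s * cj < s * 1 by rewrite ltr_pM2l.
  have su : rho + s = 2 - delta^-1 by rewrite /s; ring.
  by move=> *; apply/andP; split; lra.
pose N := size_seq delta.
pose Q j d := [/\ defect R d (N d) (dim_seq (lo j) d) <= j.+1%:R^-1,
   j%:R <= defect R d (N d) (dim_seq (up j) d),
   `|rho - (dim_seq (lo j) d)%:R / d%:R| <= c j
 & `|rho - (dim_seq (up j) d)%:R / d%:R| <= c j].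
have Qev j : \forall d \near \oo, Q j d.
  have /andP[l0 l1] := lo_itv j; have /andP[u0 u1] := up_itv j.
  have l01 : 0 <= lo j < 1 by apply/andP; split; lra.
  have u01 : 0 <= up j < 1 by apply/andP; split; rewrite /s in s1; lra.
  have lad := admissible_seqs d01 l01; have uad := admissible_seqs d01 u01.
  have lr : 0 < lo j < 2 - delta^-1 by apply/andP; split; lra.
  have ur : 0 < up j < 2 - delta^-1 by apply/andP; split; lra.
  have Gl : G delta (lo j) < 0 by apply: G_lt0 => //; [lra|rewrite -rS].
  have Gu : 0 < G delta (up j).
    by apply: G_gt0; rewrite -?rS //; case/andP: u01.
  have cl := dim_seq_cvg l01; have cu := dim_seq_cvg u01.
  (* The strict inequality leaves room for the rounding error in [dim_seq]; it holds since [rho] and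
     [s] are both below 1. *)
  have dl : `|rho - lo j| < c j.
    have -> : rho - lo j = rho * c j by rewrite /lo; ring.
    by rewrite gtr0_norm ?mulr_gt0 // gtr_pMl.
  have du : `|rho - up j| < c j.
    have -> : rho - up j = - (s * c j) by rewrite /up; ring.
    by rewrite normrN gtr0_norm ?mulr_gt0 // gtr_pMl //; lra.
  have nl : `|rho - (dim_seq (lo j) d)%:R / d%:R| @[d --> \oo] --> `|rho - lo j|.
    by apply: cvg_norm; apply: cvgB => //; exact: cvg_cst.
  have nu : `|rho - (dim_seq (up j) d)%:R / d%:R| @[d --> \oo] --> `|rho - up j|.
    by apply: cvg_norm; apply: cvgB => //; exact: cvg_cst.
  near=> d; split.
  - near: d; apply: (defect_small hd lr lad Gl); rewrite invr_gt0 //.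
  - near: d; exact: (defect_large hd ur uad _ Gu).
  - near: d; exact: (cvgr_le _ nl).
  - near: d; exact: (cvgr_le _ nu).
have [J Jy QJ] := diagonal_extraction Qev.
exists (fun d => if odd d then dim_seq (up (J d)) d else dim_seq (lo (J d)) d), N.
have Jinv (e : R) : 0 < e -> \forall d \near \oo, (J d).+1%:R^-1 <= e.
  move=> e0; near=> d.
  have : (Num.truncn e^-1 <= J d)%N by near: d; exact: Jy.
  move=> h; rewrite -[e]invrK lef_pV2 ?posrE ?invr_gt0 //.
  have ei0 : 0 <= e^-1 by rewrite invr_ge0 ltW.
  have /andP[_ /ltW h'] := truncn_itv ei0.
  by apply: (le_trans h'); rewrite ler_nat.
split.
  split; last first.
  - apply/cvgrPdist_le => e e0; near=> d.
    have [_ _ h1 h2] : Q (J d) d by near: d; exact: QJ.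
    have ce : c (J d) <= e.
      apply: (@le_trans _ _ (J d).+1%:R^-1); last by near: d; exact: Jinv.
      by rewrite lef_pV2 ?posrE // ler_nat.
    by case: ifP => _; [exact: le_trans h2 ce|exact: le_trans h1 ce].
  - by apply: size_seq_cvg; lra.
  move=> d d2; rewrite (size_seqP d01) ?(ltnW d2) // andbT.
  by case: ifP => _; exact: dim_seqP.
move=> e A e0; near=> d.
have [q1 q2 _ _] : Q (J d) d by near: d; exact: QJ.
case: (odd d).
  apply: le_trans q2; apply: (@le_trans _ _ (Num.truncn `|A|).+1%:R).
    apply: (le_trans (ler_norm _)); apply: ltW.
    by have /andP[_] := truncn_itv (normr_ge0 A).
  by rewrite ler_nat; near: d; exact: Jy.
by apply: (le_trans q1); near: d; exact: Jinv.
Unshelve. all: by end_near.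
Qed.

Theorem theorem3 (R : realType)
  (phi : forall d : nat, probability (borel_rV R d) R)
  (phi_even : forall d : nat, even_measure (phi d))
  (phi_hyp : forall d : nat, null_on_hyperplanes (phi d))
  (disp : nat -> nat -> measure_display)
  (Omega : forall d N : nat, measurableType (disp d N))
  (P : forall d N : nat, probability (Omega d N) R)
  (X : forall d N : nat, 'I_N -> {RV (P d N) >-> borel_rV R d})
  (X_iid : forall d N : nat, (d < N)%N -> iid_sample (phi d) (X d N))
  (delta rho : R)
  (hdelta : 2^-1 < delta < 1)
  (hrho : 0 < rho < 2 - delta^-1) :
  (forall k N : nat -> nat, admissible delta rho k N ->
     [/\ exists g : nat -> R,
           (forall d : nat, (2 <= d)%N ->
              face_defect (X d (N d)) (k d) =
              ((N d)%:R^-1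
               * expR ((N d)%:R * G (d%:R / (N d)%:R) ((k d)%:R / d%:R))
               * g d)%:E) /\
           (exists a b : R,
              [/\ 0 < a, a <= b
                & forall d : nat, (2 <= d)%N -> a <= g d <= b]),
         rho < rho_S delta ->
           face_defect (X d (N d)) (k d) @[d --> \oo] --> 0%E
       & rho_S delta < rho ->
           face_defect (X d (N d)) (k d) @[d --> \oo] --> +oo%E])
  /\
  (rho = rho_S delta ->
     exists k N : nat -> nat,
       [/\ admissible delta rho k N,
           limn_einf (fun d : nat => face_defect (X d (N d)) (k d)) = 0%E
         & limn_esup (fun d : nat => face_defect (X d (N d)) (k d)) = +oo%E]).
Proof.
have fdE k N d : admissible delta rho k N -> (2 <= d)%N ->
    face_defect (X d (N d)) (k d) = (defect R d (N d) (k d))%:E.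
  move=> [kN _ _] d2; have /and3P[_ kd dN] := kN d d2.
  exact: (face_defectE (phi_even d) (phi_hyp d) (X_iid _ _ dN) kd).
have fd_ge0 k N d : admissible delta rho k N -> (2 <= d)%N ->
    0 <= defect R d (N d) (k d).
  by move=> [kN _ _] d2; have /and3P[_ kd dN] := kN d d2; exact: ltW (defect_gt0 _ kd dN).
split=> [k N kN|rS]; last first.
  have [k [N [kN osc]]] := defect_oscillates hdelta hrho rS; exists k, N; split=> //.
    apply: limn_einf_eq0.
      near=> d; have d2 : (2 <= d)%N by near: d; exact: nbhs_infty_ge.
      by rewrite fdE // lee_fin fd_ge0.
    move=> e e0 n; have [M _ MP] := osc e 0 e0.
    (* Doubling gives an even index beyond all thresholds; its successor serves as the odd index for
       the upper limit. *)
    pose m := (maxn 2 (maxn n M)).*2.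
    have m2 : (maxn 2 (maxn n M) <= m)%N by rewrite /m -addnn leq_addr.
    have [m2' nm Mm] : [/\ (2 <= m)%N, (n <= m)%N & (M <= m)%N].
      by move: m2; rewrite !geq_max => /and3P[].
    exists m => //; rewrite fdE // lee_fin.
    by have := MP m Mm; rewrite /m odd_double.
  apply: limn_esup_eqy => A n; have [M _ MP] := osc 1 A ltr01.
  pose m := (maxn 2 (maxn n M)).*2.+1.
  have m2 : (maxn 2 (maxn n M) <= m)%N by rewrite /m -addnn ltnW // ltnS leq_addr.
  have [m2' nm Mm] : [/\ (2 <= m)%N, (n <= m)%N & (M <= m)%N].
    by move: m2; rewrite !geq_max => /and3P[].
  exists m => //; rewrite fdE // lee_fin.
  by have := MP m Mm; rewrite /m /= odd_double.
have rho1 := rho_lt1 hdelta hrho; have /andP[r0 r1] := hrho.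
split.
- exists (scaled_defect R k N); split=> [d d2|].
    by rewrite fdE // (defect_scaledE kN d2).
  exact: (scaled_defect_bounded hdelta hrho kN).
- move=> rS; have G0 := G_lt0 hdelta (ltW r0) rS.
  have h : (defect R d (N d) (k d))%:E @[d --> \oo] --> 0%:E.
    apply: cvg_EFin; first by near=> d.
    apply/cvgrPdist_le => e e0; near=> d.
    have d2 : (2 <= d)%N by near: d; exact: nbhs_infty_ge.
    rewrite sub0r normrN ger0_norm ?fd_ge0 //.
    by near: d; exact: (defect_small hdelta hrho kN G0).
  apply: cvg_trans h; apply: near_eq_cvg; near=> d.
  by rewrite fdE //; near: d; exact: nbhs_infty_ge.
- move=> rS; have G0 := G_gt0 hdelta rS rho1.
  apply/cvgeyPge => A; near=> d.
  rewrite fdE //; last by near: d; exact: nbhs_infty_ge.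
  by rewrite lee_fin; near: d; exact: (defect_large hdelta hrho kN).
Unshelve. all: by end_near.
Qed.
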